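(* Let $A$ be a bounded set in a real Banach space $X$ and let $\xi<\omega_1$. Then $$2\operatorname{sm}_{\xi+1}(A)\le \operatorname{wbs}_\xi(A)\le \operatorname{wbs}^s_\xi(A)\le 2\operatorname{wus}_{\xi+1}(A)\le 4\operatorname{sm}_{\xi+1}(A).$$
   Context: **Notation.** $\mathbb N=\{1,2,\dots\}$; $\omega_1$ is the first uncountable ordinal. For an infinite $M\subseteq\mathbb N$, $[M]$ is the set of all infinite subsets of $M$; $[\mathbb N]^{<\infty}$ is the set of finite subsets of $\mathbb N$. Writing $M=(m_n)_{n\in\mathbb N}$ means $M=\{m_n\}$ and $m_1<m_2<\cdots$. For finite sets, $A<B$ means $\max A<\min B$, and $n\le A$ means $n\le\min A$. $B_{X^*}$ is the closed unit ball of the dual. $(e_n)$ are the canonical unit vectors. For $a=(a_n)\in\ell_1$ and a bounded sequence $(x_n)$ in a Banach space, $a\cdot(x_k)_{k\in\mathbb N}=\sum_n a_nx_n$; $\operatorname{supp}a=\{n:a_n\ne0\}$. **Fixed sequences.** For every countable limit ordinal $\xi$ fix once and for all a strictly increasing sequence $(\xi_n)_{n\in\mathbb N}$ of successor ordinals with $\sup_n\xi_n=\xi$. **Schreier families.** $\mathcal S_0=\{\{n\}:n\in\mathbb N\}\cup\{\emptyset\}$; $\mathcal S_{\xi+1}=\{\bigcup_{i=1}^nF_i: n\le F_1<\cdots<F_n,\ F_i\in\mathcal S_\xi,\ n\in\mathbb N\}\cup\{\emptyset\}$; for $\xi$ limit, $\mathcal S_\xi=\{F\in\mathcal S_{\xi_n}: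 n\le F,\ n\in\mathbb N\}\cup\{\emptyset\}$. For $M=(m_n)\in[\mathbb N]$, $\mathcal S_\xi^M=\{\{m_i:i\in F\}:F\in\mathcal S_\xi\}$. **Repeated averages.** For $M=(m_n)\in[\mathbb N]$ and $\xi<\omega_1$ define $(\xi_n^M)_{n\in\mathbb N}$ in $\ell_1$ recursively. (1) If $\xi=0$: $\xi_n^M=e_{m_n}$. (2) If $\xi=\zeta+1$: $k_1=0$, $s_n=\min\operatorname{supp}\zeta^M_{k_n+1}$, $k_{n+1}=k_n+s_n$, and $\xi_n^M=\frac1{s_n}\sum_{i=k_n+1}^{k_n+s_n}\zeta_i^M$. (3) If $\xi$ is a limit, write $[\xi_n]^N_j$ for the $j$-th term of the already defined sequence for the ordinal $\xi_n$ and the set $N$; put $M_1=M$, $n_1=\min M_1$, $M_{j}=M_{j-1}\setminus\operatorname{supp}[\xi_{n_{j-1}}]_1^{M_{j-1}}$, $n_j=\min M_j$, and $\xi_j^M=[\xi_{n_j}]_1^{M_j}$. **Quantities.** For a bounded sequence $(x_n)$: $\operatorname{ca}(x_n)=\inf_n\sup\{\|x_k-x_l\|:k,l\ge n\}$, $\operatorname{cca}(x_n)=\operatorname{ca}\big(\frac1n\sum_{i=1}^nx_i\big)$, $$\widetilde{\operatorname{cca}}_\xi((x_n))=\inf_{M\in[\mathbb N]}\operatorname{cca}\big((\xi_n^M\cdot(x_k)_k)_n\big),\qquad \widetilde{\operatorname{cca}}{}^s_\xi((x_n))=\sup_{M\in[\mathbb N]}\inf_{N\in[M]}\operatorname{cca}\big((\xi_n^N\cdot(x_k)_k)_n\big).$$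 $\operatorname{wbs}_\xi(A)$ (resp. $\operatorname{wbs}^s_\xi(A)$) is the supremum of $\widetilde{\operatorname{cca}}_\xi((x_n))$ (resp. $\widetilde{\operatorname{cca}}{}^s_\xi((x_n))$) over all sequences $(x_n)$ in $A$ that converge weakly in $X$. A bounded sequence $(x_n)$ *generates an $\ell_1^\xi$-spreading model with constant $c>0$* if $\|\sum_{i\in F}\alpha_ix_i\|\ge c\sum_{i\in F}|\alpha_i|$ for all $F\in\mathcal S_\xi$ and $(\alpha_i)\in\mathbb R^F$. $\operatorname{sm}_\xi(A)$ is the supremum of all $c>0$ for which there is a sequence $(x_n)$ in $A$ weakly convergent to some $x\in X$ such that $(x_n-x)$ generates an $\ell_1^\xi$-spreading model with constant $c$ ($\sup\emptyset=0$). For a weakly null sequence $(y_n)$ and $\delta>0$, $\mathcal F_\delta((y_n))=\{F\in[\mathbb N]^{<\infty}:\exists x^*\in B_{X^*}\ \forall n\in F\ x^*(y_n)\ge\delta\}$. A sequence $(x_n)$ weakly convergent to $x$ is *$(\xi,c)$-large* ($c>0$) if there is $M\in[\mathbb N]$ with $\mathcal S_\xi^M\subseteq\mathcal F_c((x_n-x))$. $\operatorname{wus}_\xi(A)$ is the supremum of all $c>0$ for which there is a weakly convergent (in $X$) sequence in $A$ that is $(\xi,c)$-large ($\sup\emptyset=0$). *)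

(* Defs.v *)
From HB Require Import structures.
From mathcomp Require Import all_boot all_order all_algebra.
From mathcomp Require Import finmap.
From mathcomp Require Import all_classical all_reals all_analysis.
From mathcomp Require Import wochoice.

Set Implicit Arguments.
Unset Strict Implicit.
Unset Printing Implicit Defensive.

Import Order.TTheory GRing.Theory Num.Theory.
Import numFieldNormedType.Exports.

Local Open Scope classical_set_scope.

Lemma countableU (T : Type) (A B : set T) :
  countable A -> countable B -> countable (A `|` B).
Proof.
move=> cA cB.
have -> : A `|` B = \bigcup_(b in [set: bool]) (if b then A else B).
  apply/seteqP; split=> x /=; first by case; [exists true|exists false].
  by case=> -[] _; [left|right].
by apply: bigcup_countable => //; case.
Qed.

Section OrderScope.
Local Open Scope order_scope.

(** [omega1] characterises the ordinal $\omega_1$ up to a unique isomorphism: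
    an uncountable well-order all of whose proper initial segments are
    countable.  The elements of [W : omega1] are the countable ordinals.
    Such an order exists, by [omega1_inhabited] below, and carries a choice of
    fundamental sequences, by [fundseq_inhabited]. *)
Record omega1 := Omega1 {
  ordinal_disp : Order.disp_t;
  ordinals :> orderType ordinal_disp;
  ordinals_wf : well_founded (fun x y : ordinals => x < y);
  ordinals_countable : forall x : ordinals, countable [set y | y < x];
  ordinals_uncountable : ~ countable [set: ordinals] }.

Section Ordinals.
Variable W : omega1.
Implicit Types x y z : W.

Definition is_zero x := forall y, x <= y.

Definition succ_of x y := x < y /\ forall z, x < z -> y <= z.

Definition is_succ y := exists x, succ_of x y.

Definition is_limit x := ~ is_zero x /\ ~ is_succ x.

(** The default value [x] is never used, by [osuccP]. *)
Definition osucc x : W := xget x (succ_of x).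

Lemma ordinals_min (P : set W) : P !=set0 ->
  exists2 x, P x & forall y, P y -> x <= y.
Proof.
move=> [x0 Px0]; apply: contrapT => nmin.
have nP x : ~ P x.
  elim: (ordinals_wf x) => {}x _ IH Px; apply: nmin; exists x => // y Py.
  by rewrite leNgt; apply/negP => /IH.
exact: (nP x0).
Qed.

Lemma osuccP x : succ_of x (osucc x).
Proof.
rewrite /osucc; case: xgetP => // nsucc.
have [[z xz]|nz] := pselect ([set z | x < z] !=set0).
  have [y xy ymin] := @ordinals_min [set z | x < z] (ex_intro _ z xz).
  by case: (nsucc y).
exfalso; apply: (@ordinals_uncountable W).
have -> : [set: W] = ([set y | (y < x)%O] `|` [set x])%classic.
  apply/seteqP; split=> // y _ /=.
  case: (ltgtP y x) => [yx|xy|->]; [by left| |by right].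
  by exfalso; apply: nz; exists y.
by apply: countableU; [exact: ordinals_countable|exact: countable1].
Qed.

End Ordinals.

(** A sequence indexed by $\mathbb N=\{1,2,\dots\}$ is a function on [nat] whose
    value at [0] is irrelevant.  Together, [fs_lt] and [fs_lub] say that
    $\sup_{n\ge1}\xi_n=\xi$; the strict inequality in [fs_lt] is automatic for
    a strictly increasing sequence, and for [n = 0] it only constrains the dummy
    term. *)
Record fundseq (W : omega1) := Fundseq {
  fs :> W -> nat -> W;
  fs_lt : forall xi n, is_limit xi -> fs xi n < xi;
  fs_succ : forall xi n, is_limit xi -> (0 < n)%N -> is_succ (fs xi n);
  fs_incr : forall xi m n, is_limit xi -> (0 < m < n)%N -> fs xi m < fs xi n;
  fs_lub : forall xi eta, is_limit xi ->
    (forall n, (0 < n)%N -> fs xi n <= eta) -> xi <= eta }.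

(** Definition by transfinite recursion along fixed fundamental sequences;
    see the equations [ord_rec0], [ord_recS] and [ord_rec_lim]. *)
Section OrdRec.
Variables (W : omega1) (L : fundseq W) (T : Type).
Variables (z : T) (s : T -> T) (l : (nat -> T) -> T).

Definition ord_rec_body (xi : W) (rec : forall eta, eta < xi -> T) : T :=
  match pselect (is_zero xi) with
  | left _ => z
  | right nz =>
    match pselect (is_succ xi) with
    | left sxi => s (rec (projT1 (cid sxi)) (proj1 (projT2 (cid sxi))))
    | right ns => l (fun n => rec (L xi n) (fs_lt L n (conj nz ns)))
    end
  end.

Definition ord_rec : W -> T :=
  Fix (@ordinals_wf W) (fun=> T) ord_rec_body.

Lemma ord_recE xi : ord_rec xi = ord_rec_body (fun eta (_ : eta < xi) => ord_rec eta).
Proof.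
rewrite /ord_rec Fix_eq // => x f g fg.
by congr ord_rec_body; apply: functional_extensionality_dep => y;
  apply: functional_extensionality_dep => yx; exact: fg.
Qed.

Lemma ord_rec0 xi : is_zero xi -> ord_rec xi = z.
Proof. by rewrite ord_recE /ord_rec_body; case: pselect. Qed.

Lemma ord_recS xi : ord_rec (osucc xi) = s (ord_rec xi).
Proof.
have [xilt ximin] := osuccP xi.
rewrite ord_recE /ord_rec_body; case: pselect => [/(_ xi)|_].
  by rewrite leNgt xilt.
case: pselect => [e|[]]; last by exists xi; exact: osuccP.
case: cid => x [/= xlt xmin]; congr (s (ord_rec _)).
case: (ltgtP x xi) => // [/xmin|/ximin].
- by rewrite leNgt xilt.
- by rewrite leNgt xlt.
Qed.

Lemma ord_rec_lim xi : is_limit xi -> ord_rec xi = l (fun n => ord_rec (L xi n)).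
Proof.
move=> [nz ns]; rewrite ord_recE /ord_rec_body.
by case: pselect => // ?; case: pselect.
Qed.

End OrdRec.

End OrderScope.

Section PositiveIntegers.
Implicit Types (M P : set nat) (F G : {fset nat}).

Definition posnat : set nat := [set n | (0 < n)%N].

(** $[M]$; in particular $[\mathbb N]$ is [infsub posnat]. *)
Definition infsub M : set (set nat) := [set N | N `<=` M /\ infinite_set N].

(** [0] if [P] is empty. *)
Definition nat_min P : nat :=
  xget 0%N [set m | P m /\ forall k, P k -> (m <= k)%N].

(** [elt M n] is $m_n$, where $M=\{m_1<m_2<\cdots\}$. *)
Definition elt M (n : nat) : nat :=
  nat_min (iter n.-1 (fun N => N `\ nat_min N) M).

(** Only meaningful for nonempty sets. *)
Definition fset_before F G := forall i j, i \in F -> j \in G -> (i < j)%N.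

Definition le_fset (n : nat) F := forall i, i \in F -> (n <= i)%N.

End PositiveIntegers.

Section Schreier.
Variables (W : omega1) (L : fundseq W).

Definition schreier_zero : set {fset nat} :=
  [set F | F = fset0 \/ exists2 n, (0 < n)%N & F = [fset n]%fset].

(** The $F_i$ are nonempty, as required for $\min F_i$ and $\max F_i$ to make
    sense. *)
Definition schreier_succ (S : set {fset nat}) : set {fset nat} :=
  [set F | F = fset0 \/
    exists (n : nat) (G : nat -> {fset nat}),
      [/\ (0 < n)%N,
          forall i, (1 <= i <= n)%N -> S (G i) /\ G i <> fset0,
          le_fset n (G 1%N),
          forall i, (1 <= i < n)%N -> fset_before (G i) (G i.+1) &
          F = (\bigcup_(i <- index_iota 1 n.+1) G i)%fset]].

Definition schreier_lim (S : nat -> set {fset nat}) : set {fset nat} :=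
  [set F | F = fset0 \/ exists n : nat, [/\ (0 < n)%N, le_fset n F & S n F]].

Definition schreier : W -> set {fset nat} :=
  ord_rec L schreier_zero schreier_succ schreier_lim.

(** $\mathcal S_\xi^M$ *)
Definition schreier_on (xi : W) (M : set nat) : set {fset nat} :=
  [set [fset elt M i | i in F]%fset | F in schreier xi].

End Schreier.

Local Open Scope ring_scope.

Section RepeatedAverages.
Variables (R : realType) (W : omega1) (L : fundseq W).

(** Elements of $\ell_1$ are represented by their coordinates; the vectors below
    are finitely supported. *)
Definition supp (a : nat -> R) : set nat := [set n | a n != 0].

Definition unitvec (m : nat) : nat -> R := fun i => (i == m)%:R.

Definition avg_zero (M : set nat) (n : nat) : nat -> R := unitvec (elt M n).

Section Successor.
Variable zeta : set nat -> nat -> nat -> R.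
Variable M : set nat.

(** $k_1=0$ and $k_{n+1}=k_n+s_n$ *)
Definition block_start (n : nat) : nat :=
  iter n.-1 (fun k => k + nat_min (supp (zeta M k.+1)))%N 0%N.

(** $s_n$ *)
Definition block_size (n : nat) : nat :=
  nat_min (supp (zeta M (block_start n).+1)).

Definition avg_succ (n : nat) : nat -> R := fun i =>
  (block_size n)%:R^-1 *
  \sum_((block_start n).+1 <= j < (block_start n + block_size n).+1) zeta M j i.

End Successor.

Section Limit.
(** [zetas n N j] stands for $[\xi_n]^N_j$. *)
Variable zetas : nat -> set nat -> nat -> nat -> R.
Variable M : set nat.

(** $M_j$ *)
Definition remaining (j : nat) : set nat :=
  iter j.-1 (fun N => (N `\` supp (zetas (nat_min N) N 1%N))%classic) M.

Definition avg_lim (j : nat) : nat -> R :=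
  zetas (nat_min (remaining j)) (remaining j) 1%N.

End Limit.

(** [repavg xi M n] is $\xi^M_n$. *)
Definition repavg : W -> set nat -> nat -> nat -> R :=
  ord_rec L avg_zero avg_succ avg_lim.

End RepeatedAverages.

(** The suprema and infima below are taken in [R], where [sup set0 = 0].  When
    the sequences take their values in a bounded set all the sets involved are
    bounded, so that [sup] and [inf] have their usual meaning. *)
Section Quantities.
Variables (R : realType) (X : completeNormedModType R).
Implicit Types (x y : nat -> X) (A : set X) (a : nat -> R).

Definition ca x : R :=
  inf [set sup [set d | exists k l,
                  [/\ (n <= k)%N, (n <= l)%N & d = `|x k - x l|]] | n in posnat].

Definition cca x : R :=
  ca (fun n => n%:R^-1 *: \sum_(1 <= i < n.+1) x i).

(** $a\cdot(x_k)_{k\in\mathbb N}$ *)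
Definition l1_dot a x : X := limn (fun n => \sum_(1 <= k < n) a k *: x k).

Definition dual : set {linear X -> R^o} :=
  [set f : {linear X -> R^o} | continuous (f : X -> R^o)].

Definition dual_norm (f : {linear X -> R^o}) : R :=
  sup [set `|f v| | v in [set v : X | `|v| <= 1]].

Definition dual_ball : set {linear X -> R^o} :=
  [set f : {linear X -> R^o} | dual f /\ dual_norm f <= 1].

Definition weakly_cvg x (v : X) :=
  forall f : {linear X -> R^o}, dual f -> (fun n => f (x n)) @ \oo --> f v.

Definition seq_in A x := forall n, (0 < n)%N -> A (x n).

Section Families.
Variables (W : omega1) (L : fundseq W).
Implicit Types (xi : W) (M N : set nat).

(** $\operatorname{cca}\big((\xi_n^M\cdot(x_k)_k)_n\big)$ *)
Definition cca_along xi x M : R :=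
  cca (fun n => l1_dot (repavg R L xi M n) x).

Definition cca_tilde xi x : R :=
  inf [set cca_along xi x M | M in infsub posnat].

Definition cca_tilde_s xi x : R :=
  sup [set inf [set cca_along xi x N | N in infsub M] | M in infsub posnat].

Definition wbs xi A : R :=
  sup [set cca_tilde xi x | x in
         [set x | seq_in A x /\ exists v, weakly_cvg x v]].

Definition wbs_s xi A : R :=
  sup [set cca_tilde_s xi x | x in
         [set x | seq_in A x /\ exists v, weakly_cvg x v]].

Definition spreading_model xi x (c : R) :=
  forall (F : {fset nat}) (alpha : nat -> R), schreier L xi F ->
    c * (\sum_(i <- F) `|alpha i|) <= `|\sum_(i <- F) alpha i *: x i|.

Definition sm xi A : R :=
  sup [set c : R | 0 < c /\ exists x v,
         [/\ seq_in A x, weakly_cvg x v &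
             spreading_model xi (fun n => x n - v) c]].

(** $\mathcal F_\delta((y_n))$ *)
Definition big_family y (delta : R) : set {fset nat} :=
  [set F | [set` F] `<=` posnat /\
           exists2 f, dual_ball f & forall n, n \in F -> delta <= f (y n)].

(** $(x_n)$, with weak limit $v$, is $(\xi,c)$-large *)
Definition large xi x (v : X) (c : R) :=
  exists2 M, infsub posnat M &
    schreier_on L xi M `<=` big_family (fun n => x n - v) c.

Definition wus xi A : R :=
  sup [set c : R | 0 < c /\ exists x v,
         [/\ seq_in A x, weakly_cvg x v & large xi x v c]].

End Families.
End Quantities.

Section Existence.
Local Open Scope order_scope.

Lemma succ_lt_limit (W : omega1) (xi y : W) :
  is_limit xi -> y < xi -> osucc y < xi.
Proof.
move=> [_ ns] yxi; have [_ ymin] := osuccP y.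
rewrite lt_neqAle ymin // andbT; apply/eqP => e.
by apply: ns; exists y; rewrite -e; exact: osuccP.
Qed.

Lemma fundseq_inhabited (W : omega1) : inhabited (fundseq W).
Proof.
have ex (xi : W) : exists g : nat -> W, is_limit xi ->
  [/\ forall n, g n < xi, forall n, is_succ (g n),
      forall m n, (m < n)%N -> g m < g n &
      forall eta, (forall n, (0 < n)%N -> g n <= eta) -> xi <= eta].
  have [lim|nlim] := pselect (is_limit xi); last by exists (fun=> xi) => /nlim.
  have [y0 y0xi] : exists y, y < xi.
    have [/existsNP[y /negP]] := lim; rewrite -ltNge => yxi _.
    by exists y.
  have /countable_injP[f finj] := ordinals_countable xi.
  pose e n : W := xget y0 [set y | y < xi /\ f y = n].
  have exi n : e n < xi by rewrite /e; case: xgetP => // y -> [].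
  have fe y : y < xi -> e (f y) = y.
    rewrite /e; case: xgetP => [z -> [zxi fzy] yxi|/(_ y) h yxi].
      by apply: finj; rewrite ?inE.
    by case: h.
  pose g := fix g n := osucc (if n is n'.+1 then Order.max (g n') (e n) else e 0%N).
  have gxi n : g n < xi.
    elim: n => [|n IH] /=; apply: succ_lt_limit => //.
    by rewrite gt_max IH exi.
  have gS n : g n < g n.+1.
    rewrite /=; apply: le_lt_trans (proj1 (osuccP _)).
    by rewrite le_max lexx.
  have eg n : e n < g n.
    by case: n => [|n] /=; apply: le_lt_trans (proj1 (osuccP _));
      rewrite ?le_max lexx ?orbT.
  exists g => _; split=> //.
  - by case=> [|n] /=; eexists; exact: osuccP.
  - move=> m n; elim: n => // n IH; rewrite ltnS leq_eqVlt.
    by move=> /predU1P[->//|/IH/lt_trans]; apply.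
  - move=> eta geta; rewrite leNgt; apply/negP => etaxi.
    have := eg (f eta); rewrite fe // ltNge => /negP; apply.
    by apply: le_trans (geta (f eta).+1 isT); exact/ltW.
have {ex}[g gP] := @choice _ _ _ ex.
split; exists g.
- by move=> xi n /gP[].
- by move=> xi n /gP[].
- by move=> xi m n /gP[_ _ gincr _] /andP[_ /gincr].
- by move=> xi eta /gP[_ _ _ glub] /glub.
Qed.

Section Omega1Exists.
Let T : Type := set nat.

Lemma set_nat_uncountable : ~ countable [set: T].
Proof.
move=> /countable_injP[f finj].
pose D : set nat := [set n | exists2 B : T, f B = n & ~ B n].
have [Df|nDf] := pselect (D (f D)).
  case: (Df) => B fB; have -> : B = D by apply: finj => //; exact: mem_setT.
  exact.
by apply: (nDf); exists D.
Qed.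

Let r : rel T := sval (well_ordering_principle T).

Let rwo : well_order r.
Proof. exact: svalP. Qed.

Let rmin (P : set T) : P !=set0 -> exists2 x, P x & forall y, P y -> r x y.
Proof.
move=> [x Px]; have [|z [[zP zmin] _]] := @rwo [pred x | `[< P x >]].
  by exists x; apply/asboolP.
by exists z => [|y Py]; [exact/asboolP|apply: zmin; exact/asboolP].
Qed.

Let rchain : wo_chain r predT.
Proof. by move=> A _; exact: rwo. Qed.

Let seg : pred T := fun x => `[< countable [set y | r y x] >].
Let U : Type := {x : T | seg x}.
HB.instance Definition _ := Choice.on U.

Let leU (x y : U) := r (val x) (val y).
Let ltU (x y : U) := (y != x) && leU x y.

Let ltU_def x y : ltU x y = (y != x) && leU x y. Proof. by []. Qed.

Let leU_anti : antisymmetric leU.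
Proof.
move=> x y h; apply: val_inj.
exact: (wo_chain_antisymmetric rchain) h.
Qed.

Let leU_total : total leU.
Proof. by move=> x y; exact: (wo_chainW rchain). Qed.

Let leU_trans : transitive leU.
Proof.
move=> y x z xy yz.
have antiP u v : r u v -> r v u -> u = v.
  by move=> uv vu; apply: (wo_chain_antisymmetric rchain); rewrite ?uv.
have [|m [[]|] -> mmin] := @rmin [set val x; val y; val z]%classic.
- by exists (val x); left; left.
- by apply: mmin; right.
- rewrite /leU (antiP (val x) (val y)) //.
  by apply: mmin; left; left.
- have zy : val z = val y by apply: antiP => //; apply: mmin; left; right.
  by rewrite /leU zy.
Qed.

HB.instance Definition _ :=
  Order.isOrder.Build Order.default_display U ltU_def
    (fun _ _ => erefl) (fun _ _ => erefl) leU_anti leU_trans leU_total.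

Let U_wf : well_founded (fun x y : U => x < y).
Proof.
move=> x; apply: contrapT => nx.
have [|m] := @rmin [set t | exists2 u : U, val u = t & ~ Acc (fun x y : U => x < y) u].
  by exists (val x); exists x.
move=> [u um nu] mmin; apply: nu; split=> v vu; apply: contrapT => nv.
have := mmin _ (ex_intro2 _ _ v erefl nv); rewrite -um => uv.
by move: vu; rewrite ltNge => /negP; apply.
Qed.

Let U_seg (x : U) : countable [set y | y < x].
Proof.
have /asboolP/countable_injP[f finj] := valP x.
apply/countable_injP; exists (f \o val) => u v; rewrite !inE /= => ux vx fuv.
by apply/val_inj/finj => //; rewrite inE; [exact: (ltW ux)|exact: (ltW vx)].
Qed.

Let U_uncountable : ~ countable [set: U].
Proof.
move=> cU.
have cseg : countable [set t | seg t].
  have /countable_injP[f finj] := cU.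
  apply/countable_injP.
  exists (fun t => if insub t is Some u then f (u : U) else 0%N) => t t'.
  rewrite !inE => st st'; rewrite !insubT => ftt'.
  by have /(congr1 val) := finj _ _ (mem_setT _) (mem_setT _) ftt'.
have [|m nm mmin] := @rmin [set t | ~ seg t].
  apply: contrapT => nex; apply: set_nat_uncountable.
  apply: sub_countable cseg; apply: subset_card_le => t _ /=.
  by apply: contrapT => nt; apply: nex; exists t.
apply: nm; apply/asboolP.
apply: (@sub_countable _ _ _ ([set t | seg t] `|` [set m])%classic); last first.
  exact: countableU.
apply: subset_card_le => t /= tm.
have [st|nt] := pselect (seg t); [by left|right].
by apply: (wo_chain_antisymmetric rchain); rewrite ?tm ?mmin.
Qed.

Lemma omega1_inhabited : inhabited omega1.
Proof. by split; exact: Omega1 U_wf U_seg U_uncountable. Qed.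

End Omega1Exists.

End Existence.

(* Main.v *)
Require Import Defs.
From HB Require Import structures.
From mathcomp Require Import all_boot all_order all_algebra.
From mathcomp Require Import finmap lra zify.
From mathcomp Require Import all_classical all_reals all_analysis.

(** Let $x_n\in A$ converge weakly to $v$ and put $y_n=x_n-v$.  All the averages
    $\xi^M_n$ are convex combinations, so passing from $x$ to $y$ translates
    every mean by $v$ and leaves the oscillations unchanged.

    $2\,\mathrm{sm}_{\xi+1}\le\mathrm{wbs}_\xi$ ([ca_cesaro_cube_lower]).  If
    $(y_n)$ generates an $\ell_1^{\xi+1}$-spreading model with constant $c$, the
    subsequence $(y_{k^3})$ does so with room to spare.  Whatever $M$ is, the
    supports of $\xi^M_j,\dots,\xi^M_{j^3}$ are at most $j^3$ successive sets of
    $\mathcal S_\xi$ that lie above $j$; cubing moves them above $j^3$, so their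
    union enters $\mathcal S_{\xi+1}$.  The difference of the Cesàro means of
    orders $j^2$ and $j^3$ has coefficients of $\ell_1$-norm tending to $2$, of
    which only $O(1/j)$ sits at indices below $j$.  Hence each Cesàro sequence
    oscillates by at least $2c$.

    $\mathrm{wbs}_\xi\le\mathrm{wbs}^s_\xi$: choose $M=\mathbb N$ in the supremum.

    $\mathrm{wbs}^s_\xi\le2\,\mathrm{wus}_{\xi+1}$ ([large_of_averages]).  If the
    oscillation exceeds $2c$ for every $N\in[M]$, arbitrarily long Cesàro means
    of the $\xi^N_i\cdot y$ have norm above $c$, and for $c'<c$ a norming
    functional is at least $c'$ on a set $F$ whose mass is bounded below.  By the
    Nash-Williams--Galvin lemma ([galvin]) one of two things happens
    ([covered_dichotomy]).  Either $\mathcal S_{\xi+1}^{N}\subseteq\mathcal F_{c'}$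
    for some $N$, which is largeness; or for some $k$ and $N$ every member of
    $\mathcal F_{c'}$ inside $N$ is covered by $k$ sets of $\mathcal S_\xi$.  The
    second case is excluded by a sparse $S\in[N]$ for which a set of
    $\mathcal S_\xi$ has total mass at most $3$ over all the averages $\xi^S_i$
    together ([exists_almost_disjoint]): the mean of $n$ of them then gives $F$ a
    mass of at most $3k/n$.

    $\mathrm{wus}_{\xi+1}\le2\,\mathrm{sm}_{\xi+1}$ ([large_spreading_model]).
    Galvin's lemma, applied to interlaced sets $q_1<p_1<q_2<p_2<\cdots$, yields a
    subsequence on which a functional that is at least $c$ on the $p_i$ can be
    replaced by one that is moreover at most $\varepsilon$ on the $q_i$
    ([weakly_null_separation]).  Splitting the index set by the sign of the
    coefficients gives the spreading model constant $(c-\varepsilon)/2$.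

    The functional analysis enters through [dual_ball_cone], a form of the
    Hahn-Banach theorem that yields norming functionals and the compactness of
    the dual ball in the weak form needed here. *)

Import Order.TTheory GRing.Theory Num.Theory.
Import numFieldNormedType.Exports.

Set Implicit Arguments.
Unset Strict Implicit.
Unset Printing Implicit Defensive.

Local Open Scope classical_set_scope.

(** * Infinite sets of integers and Galvin's lemma *)

Definition tail (M : set nat) (n : nat) : set nat := [set m | M m /\ (n < m)%N].

Definition increasing (e : nat -> nat) := forall i, (e i < e i.+1)%N.

Lemma increasingP e i j : increasing e -> (i < j)%N -> (e i < e j)%N.
Proof. by move=> inc; apply: (homo_ltn ltn_trans). Qed.

Lemma increasing_le e i j : increasing e -> (i <= j)%N -> (e i <= e j)%N.
Proof.
by move=> inc; rewrite leq_eqVlt => /predU1P[->//|/(increasingP inc)/ltnW].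
Qed.

Lemma increasing_ge e i : increasing e -> (i <= e i)%N.
Proof. by move=> inc; elim: i => // i IH; apply: leq_ltn_trans IH (inc i). Qed.

Lemma infinite_natP (M : set nat) :
  infinite_set M <-> forall n, exists2 m, M m & (n < m)%N.
Proof.
split=> [infM n|unb finM].
  apply: contrapT => nex; apply: infM.
  apply: (sub_finite_set _ (finite_II n.+1)) => m Mm /=.
  by rewrite ltnS leqNgt; apply/negP => nm; apply: nex; exists m.
have [s Ms] := (finite_seqP M).1 finM.
have [m Mm] := unb (\max_(i <- s) i); rewrite ltnNge => /negP; apply.
by apply: leq_bigmax_seq => //; move: Mm; rewrite Ms.
Qed.

Lemma infinite_posnat : infinite_set posnat.
Proof. by apply/infinite_natP => n; exists n.+1. Qed.

Lemma tail_infinite M n : infinite_set M -> infinite_set (tail M n).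
Proof.
move=> /infinite_natP infM; apply/infinite_natP => k.
have [m Mm /= km] := infM (maxn n k); exists m.
  by split=> //; apply: leq_ltn_trans km; rewrite leq_maxl.
by apply: leq_ltn_trans km; rewrite leq_maxr.
Qed.

Lemma tail_sub M n : tail M n `<=` M. Proof. by move=> m []. Qed.

Lemma tail_infsub M n : infinite_set M -> infsub M (tail M n).
Proof. by move=> iM; split; [exact: tail_sub|exact: tail_infinite]. Qed.

Lemma infsub_trans M N P : infsub M N -> infsub N P -> infsub M P.
Proof. by move=> [NM _] [PN iP]; split=> // m /PN/NM. Qed.

Lemma infsub_refl M : infinite_set M -> infsub M M.
Proof. by move=> iM; split. Qed.

Lemma range_infinite e : increasing e -> infinite_set (range e).
Proof.
move=> inc; apply/infinite_natP => n; exists (e n.+1); first by exists n.+1.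
exact: leq_ltn_trans (increasing_ge n inc) (inc n).
Qed.

Section Fusion.
Variables (M : set nat).
Hypothesis infM : infinite_set M.

(** Diagonalisation: a requirement [Q n] that survives thinning and can always
    be met by thinning is met, for all [n] in one set [N] simultaneously, by the
    part of [N] above [n].  Pick the elements of [N] one at a time, each from a
    set already thinned for its predecessors; [Q 0] is met at the outset. *)
Lemma fusion (Q : nat -> set nat -> Prop) :
    (forall n N P, Q n N -> infsub N P -> Q n P) ->
    (forall n N, infsub M N -> exists2 P, infsub N P & Q n P) ->
  exists2 N, infsub M N & Q 0%N N /\ forall n, N n -> Q n (tail N n).
Proof.
move=> hered dense.
have [M0 M0M Q0] := dense 0%N _ (infsub_refl infM).
pose good (p : nat * set nat) := infsub M0 p.2.
have step (N : {N : set nat | infsub M0 N}) :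
    exists p : nat * {N : set nat | infsub M0 N},
      [/\ sval N p.1, sval p.2 `<=` tail (sval N) p.1 & Q p.1 (sval p.2)].
  case: N => N N0 /=.
  have [n Nn _] := (infinite_natP N).1 N0.2 0%N.
  have MN : infsub M (tail N n).
    exact: infsub_trans M0M (infsub_trans N0 (tail_infsub n N0.2)).
  have [P PN QP] := dense n _ MN.
  have P0 : infsub M0 P.
    exact: infsub_trans (infsub_trans N0 (tail_infsub n N0.2)) PN.
  by exists (n, exist _ P P0); split=> //; exact: PN.1.
have [f fP] := choice step.
pose S := fix S i := if i is i'.+1 then (f (S i')).2
                     else exist _ M0 (infsub_refl M0M.2).
pose e i := (f (S i)).1.
have eS i : sval (S i) (e i) by have [] := fP (S i).
have ST i : sval (S i.+1) `<=` tail (sval (S i)) (e i) by have [] := fP (S i).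
have Smono i j : (i <= j)%N -> sval (S j) `<=` sval (S i).
  elim: j => [|j IH]; first by rewrite leqn0 => /eqP->.
  rewrite leq_eqVlt => /predU1P[->//|]; rewrite ltnS => /IH ij m /ST[+ _].
  exact: ij.
have einc : increasing e by move=> i; have /ST[] := eS i.+1.
have iN := range_infinite einc.
have NM0 : infsub M0 (range e).
  split=> // _ [i _ <-]; exact: (Smono 0%N i (leq0n i)) (eS i).
exists (range e); first exact: infsub_trans NM0.
split; first exact: hered NM0.
move=> _ [i _ <-]; have [_ _ Qi] := fP (S i).
apply: hered Qi _; split; last exact: tail_infinite.
move=> m [[j _ <-] ij].
have {}ij : (i < j)%N.
  by rewrite ltnNge; apply/negP => /(increasing_le einc); rewrite leqNgt ij.
exact: (Smono _ _ ij) (eS j).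
Qed.

End Fusion.

Lemma finitely_many_requirements (T : eqType) (Q : T -> set nat -> Prop) M :
    (forall t N P, Q t N -> infsub N P -> Q t P) ->
    (forall t N, infsub M N -> exists2 P, infsub N P & Q t P) ->
  forall (s : seq T) N, infsub M N -> exists2 P, infsub N P & forall t, t \in s -> Q t P.
Proof.
move=> hered dense; elim=> [|t s IH] N MN.
  by exists N => //; apply: infsub_refl MN.2.
have [P NP QP] := IH _ MN.
have [P' PP' QP'] := dense t P (infsub_trans MN NP).
exists P' => [|u]; first exact: infsub_trans PP'.
by rewrite inE => /predU1P[->//|/QP/hered]; apply.
Qed.

(** Every increasing list bounded by [n] is among these, so that a requirement
    on all such lists is a finite one. *)
Definition sublists n : seq (seq nat) :=
  [seq mask (val m) (iota 0 n.+1) | m : n.+1.-tuple bool].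

Lemma sublistsP n s : sorted ltn s -> (forall i, i \in s -> (i <= n)%N) ->
  s \in sublists n.
Proof.
move=> ss sn; apply/mapP.
exists (map_tuple (mem s) (iota_tuple n.+1 0)); first by rewrite mem_enum.
rewrite -[RHS]/(mask (map (mem s) (iota 0 n.+1)) (iota 0 n.+1)) -filter_mask; apply: (irr_sorted_eq ltn_trans ltnn ss) => //.
  by apply: path.sorted_filter; [exact: ltn_trans|exact: iota_ltn_sorted].
by move=> i; rewrite mem_filter mem_iota /= add0n ltnS; case: (boolP (i \in s)) => // /sn->.
Qed.

Section Galvin.
Variable B : set (seq nat).

(** Nash-Williams' combinatorial forcing: every infinite subset of [M] placed
    after [s] completes [s] to a sequence with an initial segment in [B].  Only
    the part of [M] above [s] matters. *)
Definition accepts (M : set nat) (s : seq nat) :=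
  forall e, increasing e -> (forall i, M (e i)) ->
    (forall i, i \in s -> (i < e 0)%N) -> exists n, B (s ++ mkseq e n).

Definition rejects M s := forall N, infsub M N -> ~ accepts N s.

Lemma accepts_sub M N s : accepts M s -> infsub M N -> accepts N s.
Proof. by move=> acc [NM _] e inc eN; apply: acc => // i; exact/NM/eN. Qed.

Lemma rejects_sub M N s : rejects M s -> infsub M N -> rejects N s.
Proof. by move=> rej MN P NP; apply: rej; exact: infsub_trans NP. Qed.

(** Otherwise the infinitely many [m] for which [M] accepts [s] followed by [m]
    would form a set that accepts [s]. *)
Lemma rejects_finitely M s : infinite_set M -> rejects M s ->
  exists k, forall m, M m -> (k < m)%N -> ~ accepts M (rcons s m).
Proof.
move=> iM rej; apply: contrapT => nk.
pose N := [set m | M m /\ accepts M (rcons s m)].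
have iN : infsub M N.
  split=> [m []//|]; apply/infinite_natP => k; apply: contrapT => nm.
  apply: nk; exists k => m Mm km acc; apply: nm; exists m => //.
apply: (rej N iN) => e inc eN es.
have [_ acc] := eN 0%N.
have [|||n] := acc (e \o succn).
- by move=> i; exact: inc.
- by move=> i; have [] := eN i.+1.
- move=> i; rewrite mem_rcons inE => /predU1P[->|/es/ltn_trans]; first exact: inc.
  by apply; exact: inc.
by rewrite cat_rcons => Bn; exists n.+1; rewrite /mkseq /= (iotaDl 1 0) -map_comp.
Qed.

(** A first fusion makes [N] decide each of its finite subsets.  If [N] accepts
    the empty list, the second alternative holds.  If [N] rejects it, then
    [rejects_finitely] allows a second fusion after which every finite subset of
    the new set is rejected; an element of [B] is accepted at once, so none is
    left. *)
Lemma galvin M : infinite_set M -> exists2 N, infsub M N &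
  (forall s, sorted ltn s -> (forall i, i \in s -> N i) -> ~ B s) \/
  (forall e, increasing e -> (forall i, N (e i)) -> exists n, B (mkseq e n)).
Proof.
move=> infM.
pose decides N s := accepts N s \/ rejects N s.
have decides_sub N P s : decides N s -> infsub N P -> decides P s.
  by move=> [acc|rej] NP; [left; exact: accepts_sub NP|right; exact: rejects_sub NP].
have decides_dense N s : infinite_set N -> exists2 P, infsub N P & decides P s.
  move=> iN; have [[P NP acc]|nacc] := pselect (exists2 P, infsub N P & accepts P s).
    by exists P => //; left.
  exists N; first exact: infsub_refl.
  by right=> P NP acc; apply: nacc; exists P.
pose bounded n (s : seq nat) := sorted ltn s /\ forall i, i \in s -> (i <= n)%N.
have [||N MN [N0 Nn]] := fusion infM (Q := fun n N => forall s, bounded n s -> decides N s).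
- by move=> n N P QN NP s /QN /decides_sub; apply.
- move=> n N MN.
  have [|||P NP QP] := @finitely_many_requirements _ (fun s N => decides N s) M _ _ (sublists n) N.
  + by move=> s N1 P /decides_sub; apply.
  + by move=> s N1 [_ /decides_dense]; apply.
  + by [].
  by exists P => // s [ss sn]; apply: QP; exact: sublistsP.
have iN := MN.2.
have sorted_rcons n s : sorted ltn (rcons s n) = all (ltn^~ n) s && sorted ltn s.
  by rewrite !(sorted_pairwise ltn_trans) pairwise_rcons.
have bounded_last n s : sorted ltn (rcons s n) -> bounded n (rcons s n).
  move=> ss; split=> // i; rewrite mem_rcons inE => /predU1P[->//|si].
  by move: ss; rewrite sorted_rcons => /andP[/allP/(_ i si)/ltnW].
have accepts_tail P n s : accepts (tail P n) (rcons s n) -> accepts P (rcons s n).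
  move=> acc e inc eP es; apply: acc => // i; split; first exact: eP.
  apply: leq_trans (increasing_le inc (leq0n i)); apply: es.
  by rewrite mem_rcons inE eqxx.
have decidesN s : sorted ltn s -> (forall i, i \in s -> N i) -> decides N s.
  case: (lastP s) => [|{}s n] ss sN; first exact: N0.
  have Nn' : N n by apply: sN; rewrite mem_rcons inE eqxx.
  have [acc|rej] := Nn n Nn' _ (bounded_last _ _ ss); first by left; exact: accepts_tail.
  right=> P NP acc; apply: (rej (tail P n)).
    by split; [move=> m [/NP.1 ? ?]|exact: tail_infinite NP.2].
  exact: accepts_sub acc (tail_infsub _ NP.2).
have [accN|rejN] := decidesN [::] isT (fun i => ltac:(by [])).
  by exists N => //; right=> e inc eN; apply: accN.
pose ext s P := sorted ltn s -> rejects N s -> (forall i, i \in s -> N i) ->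
  forall m, P m -> sorted ltn (rcons s m) -> rejects N (rcons s m).
have [||P NP [P0 Pn]] := fusion iN (Q := fun n P => forall s, bounded n s -> ext s P).
- move=> n P P' QP PP' s /QP{}QP ss rej sN m /PP'.1; exact: QP.
- move=> n P NP.
  have [|||P' PP' QP] := @finitely_many_requirements _ ext N _ _ (sublists n) P.
  + move=> s P1 P2 QP P12 ss rej sN m /P12.1; exact: QP.
  + move=> s P1 NP1; have [rej|nrej] := pselect (rejects N s); last first.
      by exists P1; [exact: infsub_refl NP1.2|move=> _ /nrej].
    have [k kP] := rejects_finitely iN rej.
    exists (tail P1 k); first exact: tail_infsub NP1.2.
    move=> ss _ sN m [P1m km] ssm.
    have Nm := NP1.1 _ P1m.
    case: (decidesN (rcons s m) ssm) => [i|acc|//].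
      by rewrite mem_rcons inE => /predU1P[->//|/sN].
    by case: (kP m Nm km acc).
  + by [].
  by exists P' => // s [ss sn]; apply: QP; exact: sublistsP.
have rejP s : sorted ltn s -> (forall i, i \in s -> P i) -> rejects N s.
  elim/last_ind: s => // s m IH ssm sP.
  have Pm : P m by apply: sP; rewrite mem_rcons inE eqxx.
  have {}sP i : i \in s -> P i by move=> si; apply: sP; rewrite mem_rcons inE si orbT.
  have ss : sorted ltn s by move: ssm; rewrite sorted_rcons => /andP[].
  have rej := IH ss sP.
  have sN i : i \in s -> N i by move=> /sP/NP.1.
  case: (lastP s) ss sP rej sN ssm => [|{IH}s n] ss sP rej sN ssm.
    by apply: (P0 [::]).
  have Pn' : P n by apply: sP; rewrite mem_rcons inE eqxx.
  apply: (Pn n Pn' _ (bounded_last _ _ ss)) => //; split=> //.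
  by move: ssm; rewrite sorted_rcons all_rcons => /andP[/andP[]].
exists P; first exact: infsub_trans NP.
left=> s ss sP Bs; apply: (rejP s ss sP _ (infsub_refl iN)) => e _ _ _.
by exists 0%N; rewrite cats0.
Qed.

End Galvin.
(** * Schreier families *)

Section OrdinalFacts.
Local Open Scope order_scope.
Variables (W : omega1) (L : fundseq W).
Implicit Types x y z : W.

Lemma succ_of_osucc x y : succ_of x y -> y = osucc x.
Proof.
move=> [xy ymin]; have [xs smin] := osuccP x.
by apply/eqP; rewrite eq_le ymin // smin.
Qed.

Lemma lt_osucc x : x < osucc x. Proof. exact: (osuccP x).1. Qed.

Lemma ltS_ord x y : y < osucc x -> y <= x.
Proof. by move=> yx; rewrite leNgt; apply/negP => /(osuccP x).2; rewrite leNgt yx. Qed.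

Lemma omega1_ind (P : W -> Prop) :
    (forall x, is_zero x -> P x) ->
    (forall x, P x -> P (osucc x)) ->
    (forall x, is_limit x -> (forall y, y < x -> P y) -> P x) ->
  forall x, P x.
Proof.
move=> P0 PS Plim x; elim: (ordinals_wf x) => {}x _ IH.
have [/P0//|nz] := pselect (is_zero x).
have [[z /succ_of_osucc xz]|ns] := pselect (is_succ x); last exact: Plim.
by rewrite xz; apply: PS; apply: IH; rewrite xz; exact: lt_osucc.
Qed.

Lemma fs_osucc x n : is_limit x -> (0 < n)%N -> exists z, L x n = osucc z.
Proof. by move=> lim n0; have [z /succ_of_osucc] := fs_succ L lim n0; exists z. Qed.

Lemma fs_cofinal x y : is_limit x -> y < x -> exists2 n, (0 < n)%N & y < L x n.
Proof.
move=> lim yx; apply: contrapT => nex.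
suff : x <= y by rewrite leNgt yx.
apply: (@fs_lub _ L _ _ lim) => n n0.
by rewrite leNgt; apply/negP => yn; apply: nex; exists n.
Qed.

End OrdinalFacts.

Section SchreierFacts.
Variables (W : omega1) (L : fundseq W).
Implicit Types (x y z : W) (F G : {fset nat}) (S : set {fset nat}).
Local Notation Sch := (schreier L).
Local Open Scope fset_scope.

Lemma schreier0E x : is_zero x -> Sch x = schreier_zero.
Proof. exact: ord_rec0. Qed.

Lemma schreierSE x : Sch (osucc x) = schreier_succ (Sch x).
Proof. exact: ord_recS. Qed.

Lemma schreier_limE x : is_limit x -> Sch x = schreier_lim (fun n => Sch (L x n)).
Proof. exact: ord_rec_lim. Qed.

Lemma schreier_fset0 x : Sch x fset0.
Proof.
elim/(@omega1_ind W): x => [x x0|x _|x xlim _].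
- by rewrite schreier0E //; left.
- by rewrite schreierSE; left.
- by rewrite schreier_limE //; left.
Qed.

Lemma mem_bigU (G : nat -> {fset nat}) n k :
  reflect (exists2 i, (1 <= i <= n)%N & k \in G i)
          (k \in \bigcup_(i <- index_iota 1 n.+1) G i).
Proof.
apply: (iffP (bigfcupP _ _ _ _)) => -[i].
  by rewrite mem_index_iota ltnS andbT => ? ?; exists i.
by move=> ? ?; exists i => //; rewrite mem_index_iota ltnS andbT.
Qed.

(** Empty pieces may be allowed: dropping them only lowers their number.  In this
    form the successor step passes to subsets and to images. *)
Lemma schreier_succ_union S (G : nat -> {fset nat}) n F :
    (forall i, (1 <= i <= n)%N -> S (G i)) ->
    (forall i j, (1 <= i)%N -> (i < j)%N -> (j <= n)%N -> fset_before (G i) (G j)) ->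
    le_fset n F -> (forall k, k \in F <-> exists2 i, (1 <= i <= n)%N & k \in G i) ->
  schreier_succ S F.
Proof.
move=> GS Gbefore nF FE.
have [->|/fset0Pn[k0 Fk0]] := eqVneq F fset0; first by left.
right; pose s := [seq i <- index_iota 1 n.+1 | G i != fset0].
have sE i : (i \in s) = [&& (1 <= i)%N, (i <= n)%N & G i != fset0].
  by rewrite mem_filter mem_index_iota ltnS andbC -andbA.
have ssort : sorted ltn s.
  by apply: path.sorted_filter; [exact: ltn_trans|exact: iota_ltn_sorted].
have s0 : (0 < size s)%N.
  rewrite lt0n; apply/negP => /nilP s0.
  have [i /andP[i1 iN] ki] := (FE k0).1 Fk0.
  have : i \in s by rewrite sE i1 iN; apply/fset0Pn; exists k0.
  by rewrite s0.
have nths i : (1 <= i <= size s)%N -> nth 0%N s i.-1 \in s.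
  by case: i => //= i; exact: mem_nth.
have sn : (size s <= n)%N by rewrite size_filter (leq_trans (count_size _ _)) // size_iota subn1.
exists (size s), (fun i => G (nth 0%N s i.-1)); split=> //.
- move=> i /nths; rewrite sE => /and3P[i1 iN /eqP Gi]; split=> //.
  by apply: GS; rewrite i1.
- move=> k Gk; apply: leq_trans sn _; apply: nF; apply/FE.
  have := nths 1%N; rewrite s0 /= => /(_ isT); rewrite sE => /and3P[i1 iN _].
  by exists (nth 0%N s 0) => //; rewrite i1.
- move=> i /andP[i1 iN].
  have := nths i; rewrite i1 (ltnW iN) sE => /(_ isT)/and3P[? ? _].
  have := nths i.+1; rewrite iN sE => /(_ isT)/and3P[? ? _].
  apply: Gbefore => //=.
  apply: (sorted_ltn_nth ltn_trans) => //; rewrite ?inE ?prednK //.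
  exact: ltnW.
- apply/fsetP => k; apply/idP/mem_bigU.
    move=> /FE[i /andP[i1 iN] ki].
    have si : i \in s by rewrite sE i1 iN; apply/fset0Pn; exists k.
    by exists (index i s).+1; [rewrite ltnS leq0n index_mem|rewrite /= nth_index].
  move=> [i /nths]; rewrite sE => /and3P[i1 iN _] ki.
  by apply/FE; exists (nth 0%N s i.-1) => //; rewrite i1.
Qed.

Lemma fset_before_chain (G : nat -> {fset nat}) n :
    (forall i, (1 <= i <= n)%N -> G i <> fset0) ->
    (forall i, (1 <= i < n)%N -> fset_before (G i) (G i.+1)) ->
  forall i j, (1 <= i)%N -> (i < j)%N -> (j <= n)%N -> fset_before (G i) (G j).
Proof.
move=> Gne Gb i j i1; elim: j => // j IH; rewrite ltnS leq_eqVlt => /predU1P[<-|ij] jn.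
  by apply: Gb; rewrite i1.
have j1 : (1 <= j)%N by apply: leq_trans i1 (ltnW ij).
have /eqP/fset0Pn[m Gm] : G j <> fset0 by apply: Gne; rewrite j1 ltnW.
move=> a b Ga Gb'; apply: (@ltn_trans m); first exact: IH ij (ltnW jn) _ _ Ga Gm.
by apply: (Gb j) => //; rewrite j1.
Qed.

Lemma schreier_succP S F : schreier_succ S F -> F <> fset0 ->
  exists n (G : nat -> {fset nat}),
   [/\ (0 < n)%N, forall i, (1 <= i <= n)%N -> S (G i),
    forall i j, (1 <= i)%N -> (i < j)%N -> (j <= n)%N -> fset_before (G i) (G j),
    le_fset n F & forall k, k \in F <-> exists2 i, (1 <= i <= n)%N & k \in G i].
Proof.
move=> [//|[n [G [n0 GS nG Gb ->]]]] _.
have Gall := fset_before_chain (fun i h => (GS i h).2) Gb.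
exists n, G; split=> //.
- by move=> i /GS[].
- move=> k /mem_bigU[i /andP[i1 iN] Gk].
  have [] := GS 1%N; first by rewrite n0.
  move=> _ /eqP/fset0Pn[m Gm].
  move: i1; rewrite leq_eqVlt => /predU1P[i1|i1]; first by apply: nG; rewrite i1.
  apply: leq_trans (nG m Gm) _; exact/ltnW/(Gall 1%N i).
- by move=> k; split=> /mem_bigU.
Qed.

(** Heredity and spreading together: both needed in the same induction, since a
    piece of a spread set is compared with the image of the original piece. *)
Lemma schreier_spread_sub x F G (h : nat -> nat) :
    Sch x F -> {in F &, {homo h : i j / (i < j)%N}} ->
    (forall i, i \in F -> (i <= h i)%N) -> G `<=` [fset h i | i in F] -> Sch x G.
Proof.
elim/(@omega1_ind W): x F G => [x x0|x IH|x xlim IH] F G.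
- rewrite schreier0E // => -[->|[n n0 ->]] hinc hge GF.
    left; apply/eqP; rewrite -fsubset0; apply: fsubset_trans GF _.
    by apply/fsubsetP => k /imfsetP[].
  have [->|/fset0Pn[k Gk]] := eqVneq G fset0; [by left|right].
  have Gh m : m \in G -> m = h n.
    by move=> /(fsubsetP GF)/imfsetP[i /=]; rewrite inE => /eqP-> ->.
  exists (h n); first by apply: leq_trans n0 (hge n _); rewrite inE.
  apply/fsetP => m; rewrite inE; apply/idP/eqP => [/Gh//|->].
  by rewrite -(Gh k Gk).
- rewrite schreierSE => SF hinc hge GF.
  have [->|/eqP G0] := eqVneq G fset0; first by left.
  have [F0|] := pselect (F = fset0).
    case: G0; apply/eqP; rewrite -fsubset0; apply: fsubset_trans GF _.
    by rewrite F0; apply/fsubsetP => k /imfsetP[].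
  move=> /(schreier_succP SF)[n [H [n0 HS Hb nF FE]]].
  have HF i k : (1 <= i <= n)%N -> k \in H i -> k \in F.
    by move=> ? ?; apply/FE; exists i.
  apply: (@schreier_succ_union _ (fun i => [fset k in G | k \in [fset h j | j in H i]]) n).
  + move=> i iN; apply: (IH (H i)) (HS i iN) _ _ _.
    * by move=> a b Ha Hb'; apply: hinc; exact: (HF i).
    * by move=> a Ha; apply: hge; exact: (HF i).
    * by apply/fsubsetP => k; rewrite !inE => /andP[].
  + move=> i j i1 ij jn a b; rewrite !inE => /andP[_ /imfsetP[/= a' Ha ->]].
    move=> /andP[_ /imfsetP[/= b' Hb' ->]]; apply: hinc.
    * by apply: (HF i) => //; rewrite i1 (leq_trans (ltnW ij)).
    * by apply: (HF j) => //; rewrite (leq_trans i1 (ltnW ij)).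
    * exact: Hb Ha Hb'.
  + move=> k /(fsubsetP GF)/imfsetP[/= i Fi ->].
    by apply: leq_trans (nF i Fi) (hge i Fi).
  + move=> k; split=> [Gk|[i _]]; last by rewrite !inE => /andP[].
    have /imfsetP[/= j /FE[i iN Hj] kj] := fsubsetP GF _ Gk.
    by exists i => //; rewrite !inE Gk /=; apply/imfsetP; exists j.
- rewrite schreier_limE // => -[->|[n [n0 nF SF]]] hinc hge GF.
    left; apply/eqP; rewrite -fsubset0; apply: fsubset_trans GF _.
    by apply/fsubsetP => k /imfsetP[].
  right; exists n; split=> //.
    move=> k /(fsubsetP GF)/imfsetP[/= i Fi ->].
    by apply: leq_trans (nF i Fi) (hge i Fi).
  by apply: IH SF hinc hge GF; exact: fs_lt.
Qed.

Lemma schreier_sub x F G : Sch x F -> G `<=` F -> Sch x G.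
Proof.
move=> SF GF; apply: (schreier_spread_sub (h := id)) SF _ _ _ => //.
by apply: fsubset_trans GF _; apply/fsubsetP => k Fk; apply/imfsetP; exists k.
Qed.

Lemma schreier_spread x F (h : nat -> nat) :
    Sch x F -> {in F &, {homo h : i j / (i < j)%N}} ->
    (forall i, i \in F -> (i <= h i)%N) -> Sch x [fset h i | i in F].
Proof. by move=> SF hinc hge; apply: schreier_spread_sub SF hinc hge _. Qed.

Lemma schreier_pos x F k : Sch x F -> k \in F -> (0 < k)%N.
Proof.
elim/(@omega1_ind W): x F => [x x0|x IH|x xlim IH] F.
- by rewrite schreier0E // => -[->//|[n n0 ->]]; rewrite inE => /eqP->.
- rewrite schreierSE => SF Fk.
  have F0 : F <> fset0 by move=> F0; rewrite F0 in Fk.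
  have [n [H [n0 HS Hb nF FE]]] := schreier_succP SF F0.
  exact: leq_trans n0 (nF k Fk).
- rewrite schreier_limE // => -[->//|[n [n0 nF SF]]] Fk.
  exact: leq_trans n0 (nF k Fk).
Qed.

Lemma schreier1 x n : (0 < n)%N -> Sch x [fset n].
Proof.
move=> n0; elim/(@omega1_ind W): x => [x x0|x IH|x xlim IH].
- by rewrite schreier0E //; right; exists n.
- rewrite schreierSE; apply: (@schreier_succ_union _ (fun=> [fset n]) 1) => //.
  + by move=> i j i1 ij j1; have := leq_ltn_trans i1 (leq_trans ij j1).
  + by move=> k; rewrite inE => /eqP->.
  + by move=> k; split=> [|[]//]; exists 1%N.
- rewrite schreier_limE //; right; exists 1%N; split=> //.
    by move=> k; rewrite inE => /eqP->.
  by apply: IH; exact: fs_lt.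
Qed.

Lemma schreier_osucc x F : Sch x F -> Sch (osucc x) F.
Proof.
move=> SF; rewrite schreierSE; apply: (@schreier_succ_union _ (fun=> F) 1) => //.
- by move=> i j i1 ij j1; have := leq_ltn_trans i1 (leq_trans ij j1).
- by move=> k Fk; exact: schreier_pos SF Fk.
- by move=> k; split=> [|[]//]; exists 1%N.
Qed.

(** The families increase with the ordinal only for sets beyond a threshold: at a
    limit the relevant fundamental term $\xi_m$ is available to sets above $m$. *)
Lemma schreier_eventually_mono x y : (y <= x)%O ->
  exists n, forall F, Sch y F -> le_fset n F -> Sch x F.
Proof.
rewrite le_eqVlt => /predU1P[->|]; first by exists 0%N.
elim/(@omega1_ind W): x => [x x0|x IH /ltS_ord|x xlim IH yx].
- by rewrite ltNge x0.
- rewrite le_eqVlt => /predU1P[->|/IH[n nP]]; first by exists 0%N => F /schreier_osucc.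
  by exists n => F SF nF; apply: schreier_osucc; exact: nP.
- have [m m0 ym] := fs_cofinal L xlim yx.
  have [n nP] := IH _ (fs_lt L m xlim) ym.
  exists (maxn m n) => F SF nF; rewrite schreier_limE //; right; exists m; split=> //.
    by move=> k /nF; rewrite geq_max => /andP[].
  by apply: nP => // k /nF; rewrite geq_max => /andP[].
Qed.

End SchreierFacts.
(** * Repeated averages *)

Section Enumeration.
Implicit Types (M P : set nat).

Lemma nat_minP P : P !=set0 -> P (nat_min P) /\ forall k, P k -> (nat_min P <= k)%N.
Proof.
move=> [m Pm]; rewrite /nat_min; case: xgetP => [k -> //|nP].
have exP : exists k, `[< P k >] by exists m; apply/asboolP.
case: (nP (ex_minn exP)); case: ex_minnP => k /asboolP Pk kmin.
by split=> // i Pi; apply: kmin; apply/asboolP.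
Qed.

Lemma nat_min_eq P m : P m -> (forall k, P k -> (m <= k)%N) -> nat_min P = m.
Proof.
move=> Pm mmin; have [Pn nmin] := nat_minP (ex_intro _ m Pm).
by apply/eqP; rewrite eqn_leq nmin // mmin.
Qed.

Lemma infinite_nonempty M : infinite_set M -> M !=set0.
Proof. by move=> /infinite_natP/(_ 0%N)[m Mm _]; exists m. Qed.

Lemma setD_min M : infinite_set M -> M `\ nat_min M = tail M (nat_min M).
Proof.
move=> /infinite_nonempty/nat_minP[_ mmin]; apply/seteqP; split=> m [Mm] /=.
  by move=> /eqP nm; split=> //; rewrite ltn_neqAle eq_sym nm mmin.
by move=> nm; split=> //= e; rewrite e ltnn in nm.
Qed.

Lemma tail_tail M a b : (a <= b)%N -> tail (tail M a) b = tail M b.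
Proof.
move=> ab; apply/seteqP; split=> m; first by move=> [[]].
by move=> [Mm bm]; split=> //; split=> //; exact: leq_ltn_trans bm.
Qed.

Lemma tail_pos M : M `<=` posnat -> tail M 0 = M.
Proof. by move=> Mpos; apply/seteqP; split=> m; [case|move=> Mm; split=> //; exact: Mpos]. Qed.

Section Elt.
Variable M : set nat.
Hypothesis MP : infsub posnat M.

Lemma elt1 : elt M 1 = nat_min M. Proof. by []. Qed.

Lemma iter_setD_min n :
  iter n.+1 (fun N => N `\ nat_min N) M = tail M (elt M n.+1) /\
  (elt M n.+1 < elt M n.+2)%N.
Proof.
have iM := MP.2.
have step k : iter k.+1 (fun N => N `\ nat_min N) M = tail M (elt M k.+1) ->
    (elt M k.+1 < elt M k.+2)%N.
  move=> e; have : elt M k.+2 = nat_min (tail M (elt M k.+1)) by rewrite -e.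
  move=> ->; have := nat_minP (infinite_nonempty (tail_infinite (n := elt M k.+1) iM)).
  by case=> -[].
elim: n => [|n [IH lt]].
  have e : iter 1 (fun N => N `\ nat_min N) M = tail M (elt M 1) by exact: setD_min.
  by split=> //; exact: step.
have e : iter n.+2 (fun N => N `\ nat_min N) M = tail M (elt M n.+2).
  have en : elt M n.+2 = nat_min (tail M (elt M n.+1)) by rewrite -IH.
  rewrite iterS IH setD_min -?en; last exact: tail_infinite.
  by rewrite tail_tail // ltnW.
by split=> //; exact: step.
Qed.

Lemma eltS n : elt M n.+2 = nat_min (tail M (elt M n.+1)).
Proof. by rewrite -(iter_setD_min n).1. Qed.

Lemma elt_increasing : increasing (fun n => elt M n.+1).
Proof. by move=> n; exact: (iter_setD_min n).2. Qed.

Lemma elt_in n : (0 < n)%N -> M (elt M n).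
Proof.
have iM := MP.2; case: n => // -[|n] _.
  by rewrite elt1; exact: (nat_minP (infinite_nonempty iM)).1.
by rewrite eltS; have [[]] := nat_minP (infinite_nonempty (tail_infinite (n := elt M n.+1) iM)).
Qed.

Lemma elt_ge n : (n <= elt M n)%N.
Proof.
case: n => // n; elim: n => [|n IH]; last exact: leq_ltn_trans IH (elt_increasing n).
by apply: MP.1; exact: elt_in.
Qed.

Lemma elt_lt i j : (0 < i < j)%N -> (elt M i < elt M j)%N.
Proof. by case: i j => [//|i] [//|j] /andP[_ ij]; exact: (@increasingP _ i j elt_increasing ij). Qed.

Lemma elt_onto m : M m -> exists2 n, (0 < n)%N & elt M n = m.
Proof.
move=> Mm; have iM := MP.2.
have : exists n, (elt M n.+1 <= m)%N.
  by exists 0%N; exact: (nat_minP (infinite_nonempty iM)).2.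
have bnd n : (elt M n.+1 <= m)%N -> (n <= m)%N.
  by move=> h; apply: leq_trans h; apply: ltnW; exact: elt_ge.
move=> exn; case: (ex_maxnP exn bnd) => n nm nmax; exists n.+1 => //.
apply/eqP; rewrite eqn_leq nm /= leqNgt; apply/negP => lt.
suff /nmax : (elt M n.+2 <= m)%N by rewrite ltnn.
by rewrite eltS; apply: (nat_minP _).2 => //; exists m.
Qed.

End Elt.
End Enumeration.

Section BlockAverages.
Local Open Scope ring_scope.
Variable R : realType.
Implicit Types (M : set nat) (u : nat -> nat -> R) (b : nat -> nat).

(** The structure shared by all the sequences $(\xi^M_n)$: they are convex
    combinations whose supports cut $M$ into successive intervals, the n-th one
    ending at [b n].  Recording the end points as values, not as positions in $M$,
    makes the remaining set at a limit ordinal a tail of $M$. *)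
Record block_averages M u b : Prop := BlockAverages {
  block0 : b 0%N = 0%N;
  block_supp : forall n m, u n.+1 m != 0 <-> M m /\ (b n < m <= b n.+1)%N;
  block_nonempty : forall n, exists2 m, M m & (b n < m <= b n.+1)%N;
  block_ge0 : forall n m, 0 <= u n.+1 m;
  block_sum1 : forall n T, (b n.+1 < T)%N -> \sum_(0 <= i < T) u n.+1 i = 1 }.

Section Facts.
Variables (M : set nat) (u : nat -> nat -> R) (b : nat -> nat).
Hypothesis ub : block_averages M u b.

Lemma block_increasing : increasing b.
Proof.
move=> n; have [m _ /andP[nm mn]] := block_nonempty ub n.
exact: leq_trans nm mn.
Qed.

Lemma block_min_supp n : supp (u n.+1) (nat_min (supp (u n.+1))).
Proof.
have [m Mm mb] := block_nonempty ub n.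
by apply: (nat_minP _).1; exists m; apply/(block_supp ub).
Qed.

Lemma block_min_supp_le n m : M m -> (b n < m)%N -> (nat_min (supp (u n.+1)) <= m)%N.
Proof.
move=> Mm nm; have := block_min_supp n.
rewrite /= => /(block_supp ub)[_ /andP[_ le]].
have [mn|/ltnW] := leqP m (b n.+1); last exact: leq_trans.
apply: (nat_minP _).2; first by exists m; apply/(block_supp ub); rewrite nm.
by apply/(block_supp ub); rewrite nm.
Qed.

(** The number $s_n$ of averages that are merged at a successor ordinal is the
    first element of $M$ that is still unused. *)
Lemma block_min_suppE n : nat_min (supp (u n.+1)) = nat_min (tail M (b n)).
Proof.
apply/esym/nat_min_eq; last by move=> k [Mk nk]; exact: block_min_supp_le.
by have /= /(block_supp ub)[? /andP[? _]] := block_min_supp n.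
Qed.

Lemma block_ex k s m : (b k < m <= b (k + s))%N ->
  exists2 j, (k < j <= k + s)%N & (b j.-1 < m <= b j)%N.
Proof.
elim: s => [|s IH] /andP[km ms].
  by move: (leq_trans km ms); rewrite addn0 ltnn.
have [le|lt] := leqP m (b (k + s)).
  have [|j /andP[kj js] jm] := IH; first by rewrite km.
  by exists j => //; rewrite kj addnS leqW.
by exists (k + s).+1; rewrite /= ?lt -?addnS ?ms ?leqnn ?andbT // addnS ltnS leq_addr.
Qed.

End Facts.

Lemma block_averages_zero M : infsub posnat M -> exists b, block_averages M (avg_zero R M) b.
Proof.
move=> MP; exists (fun n => if n is n'.+1 then elt M n'.+1 else 0%N).
have supp_at n m : avg_zero R M n.+1 m != 0 <-> m = elt M n.+1.
  by rewrite /avg_zero /unitvec pnatr_eq0 eqb0 negbK; split=> [/eqP|/eqP].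
split=> [//|n m|n|n m|n T nT].
- rewrite supp_at; split=> [->|[Mm]].
    split; first exact: elt_in.
    by case: n => [|n]; rewrite leqnn andbT; [apply: MP.1; exact: elt_in|exact: (elt_increasing MP)].
  case: n => [|n] /andP[nm mn]; apply/eqP; rewrite eqn_leq mn /=.
    by apply: (nat_minP _).2 => //; exists m.
  by rewrite eltS //; apply: (nat_minP _).2 => //; exists m.
- exists (elt M n.+1); first exact: elt_in.
  by case: n => [|n]; rewrite leqnn andbT; [apply: MP.1; exact: elt_in|exact: (elt_increasing MP)].
- by rewrite /avg_zero /unitvec ler0n.
- rewrite /avg_zero /unitvec (bigD1_seq (elt M n.+1)) ?mem_index_iota ?iota_uniq //=.
  by rewrite eqxx big1 ?addr0 // => i /negPf->.
Qed.

Section Succ.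
Variables (zeta : set nat -> nat -> nat -> R) (M : set nat) (bz : nat -> nat).
Hypotheses (MP : infsub posnat M) (zb : block_averages M (zeta M) bz).

Lemma block_startS n :
  block_start zeta M n.+2 = (block_start zeta M n.+1 + block_size zeta M n.+1)%N.
Proof. by []. Qed.

Lemma block_size_gt0 n : (0 < block_size zeta M n)%N.
Proof.
by have /= /(block_supp zb)[/MP.1] := block_min_supp zb (block_start zeta M n).
Qed.

Lemma avg_succ_neq0 n m : avg_succ zeta M n.+1 m != 0 <->
  M m /\ (bz (block_start zeta M n.+1) < m <= bz (block_start zeta M n.+2))%N.
Proof.
rewrite block_startS /avg_succ.
set k := block_start _ _ _; set s := block_size _ _ _.
have s0 : s%:R^-1 != 0 :> R by rewrite invr_eq0 pnatr_eq0 -lt0n block_size_gt0.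
rewrite mulf_eq0 negb_or s0 /=.
have ge0 j : (k.+1 <= j)%N -> 0 <= zeta M j m.
  by case: j => // j _; exact: (block_ge0 zb).
split=> [/eqP neq|[Mm km]].
  have : exists2 j, (k.+1 <= j < (k + s).+1)%N & zeta M j m != 0.
    apply: contrapT => nex; apply: neq; rewrite big_nat big1 // => j jk.
    by apply/eqP/negPn/negP => neq; apply: nex; exists j.
  move=> [[//|j]]; rewrite ltnS => /andP[kj js] /(block_supp zb)[Mm /andP[jm mj]].
  split=> //; apply/andP; split.
    by apply: leq_ltn_trans jm; exact: increasing_le (block_increasing zb) kj.
  by apply: leq_trans mj _; exact: increasing_le (block_increasing zb) _.
have [j /andP[kj js] jm] := block_ex km.
rewrite (bigD1_seq j) ?mem_index_iota ?iota_uniq ?ltnS ?kj //=.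
rewrite gt_eqF //; apply: ltr_pwDl.
  rewrite lt_neqAle ge0 // andbT eq_sym; case: j kj {js} jm => // j _ jm.
  exact/(block_supp zb).
rewrite big_nat_cond; apply: sumr_ge0 => i /andP[/andP[ki _] _]; exact: ge0.
Qed.

Lemma block_averages_succ : block_averages M (avg_succ zeta M)
  (fun n => bz (block_start zeta M n.+1)).
Proof.
have inc := block_increasing zb.
split=> [|n m|n|n m|n T nT].
- exact: (block0 zb).
- exact: avg_succ_neq0.
- have [m Mm /andP[nm mn]] := block_nonempty zb (block_start zeta M n.+1).
  exists m => //; rewrite nm; apply: leq_trans mn _.
  by apply: increasing_le => //; rewrite block_startS -addn1 leq_add2l block_size_gt0.
- rewrite /avg_succ mulr_ge0 ?invr_ge0 ?ler0n // big_nat sumr_ge0 // => -[|j] // _.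
  exact: (block_ge0 zb).
- rewrite /avg_succ -mulr_sumr exchange_big_nat /=.
  rewrite big_nat (eq_bigr (fun=> 1)) => [|[//|j]]; last first.
    rewrite ltnS => /andP[_ js]; apply: (block_sum1 zb).
    by apply: leq_ltn_trans nT; apply: increasing_le.
  rewrite -big_nat big_const_nat subSS addKn iter_addr_0 mulVf // pnatr_eq0 -lt0n.
  exact: block_size_gt0.
Qed.

End Succ.

Section Lim.
Variables (zetas : nat -> set nat -> nat -> nat -> R) (M : set nat).
Hypotheses (MP : infsub posnat M) (zb : forall n N, (0 < n)%N -> infsub posnat N ->
  exists b, block_averages N (zetas n N) b).

Lemma block_averages_lim : exists2 b, block_averages M (avg_lim zetas M) b &
  forall n, remaining zetas M n.+1 = tail M (b n).
Proof.
have tP c : infsub posnat (tail M c) by exact: infsub_trans (tail_infsub c MP.2).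
have min_pos c : (0 < nat_min (tail M c))%N.
  by apply: (tP c).1; apply: (nat_minP (infinite_nonempty (tP c).2)).1.
have [f fP] := choice (fun c => zb (min_pos c) (tP c)).
pose b := fix b n := if n is n'.+1 then f (b n') 1%N else 0%N.
have rem n : remaining zetas M n.+1 = tail M (b n).
  elim: n => [|n IH]; first by rewrite tail_pos //; exact: MP.1.
  have -> : remaining zetas M n.+2 = remaining zetas M n.+1 `\`
     supp (zetas (nat_min (remaining zetas M n.+1)) (remaining zetas M n.+1) 1%N) by [].
  rewrite IH; have fb := fP (b n); have f0 := block0 fb.
  have bb : (b n <= f (b n) 1)%N.
    have [m [_ bm] /andP[_ mf]] := block_nonempty fb 0; exact: leq_trans (ltnW bm) mf.
  apply/seteqP; split=> m /=.
    move=> [[Mm bm] nz]; split=> //; rewrite ltnNge; apply/negP => mf; apply: nz.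
    apply/(block_supp fb); rewrite f0 mf; split=> //.
    by rewrite andbT; exact: leq_ltn_trans bm.
  move=> [Mm fm]; split; first by split=> //; exact: leq_ltn_trans fm.
  by move=> /(block_supp fb)[_ /andP[_]]; rewrite leqNgt fm.
exists b => //; split=> // [n m|n|n m|n T nT]; rewrite /avg_lim ?rem;
  have fb := fP (b n); have f0 := block0 fb.
- rewrite (block_supp fb) f0 /=; split=> [[[Mm bm] /andP[_ ->]]|[Mm /andP[bm ->]]].
    by rewrite bm.
  by rewrite andbT; split=> //; exact: leq_ltn_trans bm.
- have [m [Mm bm] /andP[_ mf]] := block_nonempty fb 0%N.
  by exists m => //=; rewrite bm.
- exact: block_ge0 fb _ _.
- exact: block_sum1 fb _ _ nT.
Qed.

End Lim.

Variables (W : omega1) (L : fundseq W).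
Local Notation avg := (repavg R L).

Lemma repavg0E x : is_zero x -> avg x = @avg_zero R.
Proof. exact: ord_rec0. Qed.

Lemma repavgSE x : avg (osucc x) = avg_succ (avg x).
Proof. exact: ord_recS. Qed.

Lemma repavg_limE x : is_limit x -> avg x = avg_lim (fun n => avg (L x n)).
Proof. exact: ord_rec_lim. Qed.

Lemma repavg_blocks (x : W) M : infsub posnat M -> exists b, block_averages M (avg x M) b.
Proof.
elim/(@omega1_ind W): x M => [x x0|x IH|x xlim IH] M MP.
- by rewrite repavg0E //; exact: block_averages_zero.
- rewrite repavgSE; have [b xb] := IH M MP.
  eexists; exact: block_averages_succ xb.
- rewrite repavg_limE //.
  have [|b xb _] := @block_averages_lim (fun n => avg (L x n)) M MP; last by exists b.
  by move=> n N _ NP; apply: IH => //; exact: fs_lt.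
Qed.

(** The recursion for the averages mirrors that for the families: at a successor,
    $s$ blocks that start at $s$ are merged; at a limit, the family of index
    $\xi_n$ is used on a set that starts at $n$. *)
Lemma repavg_schreier (x : W) M n : infsub posnat M ->
  exists2 F, schreier L x F & forall m, m \in F <-> avg x M n.+1 m != 0.
Proof.
elim/(@omega1_ind W): x M n => [x x0|x IH|x xlim IH] M n MP.
- rewrite repavg0E //; exists [fset elt M n.+1]%fset.
    by apply: schreier1; apply: MP.1; exact: elt_in.
  move=> m; rewrite inE /avg_zero /unitvec pnatr_eq0 eqb0 negbK.
  by split=> /eqP ->.
- have [b xb] := repavg_blocks x MP; have inc := block_increasing xb.
  have /choice[F FP] : forall j, exists F, schreier L x F /\
      forall m, m \in F <-> avg x M j.+1 m != 0.
    by move=> j; have [F SF FP] := IH M j MP; exists F.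
  rewrite repavgSE.
  have neq0 := avg_succ_neq0 MP xb n; rewrite block_startS in neq0.
  set k := block_start _ _ _ in neq0; set s := block_size _ _ _ in neq0.
  have [T Tb] : exists T, forall m, (m <= b (k + s))%N -> (m < T)%N by exists (b (k + s)%N).+1.
  pose FF := [fset m in iota 0 T | avg_succ (avg x) M n.+1 m != 0]%fset.
  have FFE m : m \in FF <-> avg_succ (avg x) M n.+1 m != 0.
    rewrite !inE mem_iota add0n leq0n /=; split=> [/andP[]//|nz]; rewrite nz andbT.
    by apply: Tb; have [_ /andP[]] := (neq0 m).1 nz.
  exists FF => //.
  rewrite schreierSE; apply: (@schreier_succ_union _ (fun i => F (k + i).-1) s).
  + by move=> i _; exact: (FP _).1.
  + move=> i j i1 ij js a c.
    move=> /(FP _).2 /(block_supp xb)[_ /andP[_ ai]] /(FP _).2 /(block_supp xb)[_ /andP[jc _]].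
    apply: leq_ltn_trans ai (leq_ltn_trans _ jc); apply: increasing_le => //.
    rewrite prednK ?addn_gt0 ?i1 ?orbT //.
    by rewrite -ltnS prednK ?addn_gt0 ?(ltn_trans i1 ij) ?orbT // ltn_add2l.
  + move=> m /FFE/neq0[Mm /andP[km _]].
    exact: (block_min_supp_le xb).
  + move=> m; split.
      move=> /FFE/neq0[Mm /block_ex[j /andP[kj js] jm]].
      exists (j - k)%N; first by rewrite subn_gt0 kj leq_subLR.
      rewrite subnKC ?(ltnW kj) //; apply/(FP _).2/(block_supp xb).
      by rewrite prednK // (leq_ltn_trans _ kj).
    move=> [i /andP[i1 si] /(FP _).2/(block_supp xb)[Mm /andP[im mi]]].
    have ki : (0 < k + i)%N by rewrite addn_gt0 i1 orbT.
    rewrite prednK // in mi.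
    have mks : (m <= b (k + s))%N.
      by apply: leq_trans mi _; apply: increasing_le => //; rewrite leq_add2l.
    apply/FFE/neq0; split=> //; rewrite mks andbT.
    apply: leq_ltn_trans im; apply: increasing_le => //.
    by rewrite -ltnS prednK // -addn1 leq_add2l.
- rewrite repavg_limE //.
  have [|b xb rem] := @block_averages_lim (fun n => avg (L x n)) M MP.
    by move=> j N _ NP; exact: repavg_blocks.
  have tP : infsub posnat (tail M (b n)) by exact: infsub_trans (tail_infsub _ MP.2).
  have [[Mm _] mmin] := nat_minP (infinite_nonempty tP.2).
  have [F SF FP] := IH _ (fs_lt L (nat_min (tail M (b n))) xlim) _ 0%N tP.
  exists F; last by move=> m; rewrite FP /avg_lim rem.
  rewrite schreier_limE //; right; exists (nat_min (tail M (b n))); split=> //.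
    exact: MP.1.
  have [b' xb'] := repavg_blocks (L x (nat_min (tail M (b n)))) tP.
  by move=> m /FP/(block_supp xb')[tm _]; exact: mmin.
Qed.

End BlockAverages.

Local Open Scope ring_scope.

(** * Sparse sets with almost disjoint averages *)

Section FiniteSums.
Variable R : realType.
Implicit Types (a : nat -> R) (F : {fset nat}).

Lemma sum_cover a (s : seq nat) (I : eqType) (r : seq I) (t : I -> seq nat) :
    uniq s -> (forall m, 0 <= a m) ->
    (forall m, m \in s -> a m != 0 -> exists2 i, i \in r & m \in t i) ->
  \sum_(m <- s) a m <= \sum_(i <- r) \sum_(m <- t i) a m.
Proof.
move=> us a0 cover.
have sub (s' t' : seq nat) : uniq s' -> {subset s' <= t'} ->
    \sum_(m <- s') a m <= \sum_(m <- t') a m.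
  elim: s' t' => [|m s' IH] t' /=; first by rewrite big_nil sumr_ge0.
  move=> /andP[ms us'] st; have mt : m \in t' by apply: st; rewrite inE eqxx.
  rewrite big_cons (perm_big _ (perm_to_rem mt)) big_cons lerD2l; apply: IH => // k ks.
  have := st k; rewrite inE ks orbT => /(_ isT).
  rewrite (perm_mem (perm_to_rem mt)) inE => /predU1P[km|//].
  by rewrite -km ks in ms.
have -> : \sum_(i <- r) \sum_(m <- t i) a m = \sum_(m <- flatten (map t r)) a m.
  by rewrite big_flatten /= big_map.
rewrite (bigID (fun m => a m == 0)) /= big1 ?add0r => [|m /eqP//].
rewrite -big_filter; apply: sub => [|m]; first exact: filter_uniq.
rewrite mem_filter => /andP[am /cover/(_ am)[i ir mt]].
by apply/flatten_mapP; exists i.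
Qed.

Lemma block_mass_le1 M (u : nat -> nat -> R) b n F :
  block_averages M u b -> \sum_(m <- F) u n.+1 m <= 1.
Proof.
move=> ub; rewrite -(block_sum1 ub (ltnSn (b n.+1))).
apply: le_trans (sum_cover (r := [:: tt]) (t := fun=> index_iota 0 (b n.+1).+1) _ _ _) _.
- exact: fset_uniq.
- exact: (block_ge0 ub).
- move=> m _ /(block_supp ub)[_ /andP[_ mb]]; exists tt => //.
  by rewrite mem_index_iota.
- by rewrite big_seq1.
Qed.

(** The masses $v_i$ that a Schreier set has under successive averages are
    handled in this way: the first block met and the next one cost at most $1$
    each, and the later ones are negligible by sparsity. *)
Lemma sum_le3 (v : nat -> R) :
    (forall i, 0 <= v i <= 1) ->
    (forall i0 n, 0 < v i0 -> \sum_(i0.+2 <= i < n) v i <= 1) ->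
  forall n, \sum_(0 <= i < n) v i <= 3.
Proof.
move=> v01 vtail n.
have v0 i : 0 <= v i by have /andP[] := v01 i.
have [|nex] := pselect (exists i, (i < n)%N && (0 < v i)); last first.
  rewrite big_nat big1 // => i /andP[_ iN]; apply/eqP; rewrite eq_le v0 andbT leNgt.
  by apply/negP => vi; apply: nex; exists i; rewrite iN.
move=> exi; case: (ex_minnP exi) => i0 /andP[i0n vi0] imin.
apply: (@le_trans _ _ (\sum_(0 <= i < n + i0.+2) v i)).
  rewrite [leRHS](big_cat_nat (n := n)) ?leq_addr //= lerDl; exact: sumr_ge0.
rewrite (big_cat_nat (n := i0)) ?(leq_trans (leqW (leqnSn i0)) (leq_addl _ _)) //=.
rewrite big_nat big1 => [|i /andP[_ ii0]]; last first.
  apply/eqP; rewrite eq_le v0 andbT leNgt; apply/negP => vi.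
  have := imin i; rewrite vi (ltn_trans ii0 i0n) => /(_ isT).
  by rewrite leqNgt ii0.
have lt : (i0.+1 < n + i0.+2)%N by rewrite addnS ltnS leq_addl.
rewrite big_ltn ?(ltnW lt) // big_ltn //.
have /andP[_] := v01 i0; have /andP[_] := v01 i0.+1.
have := vtail i0 (n + i0.+2)%N vi0; lra.
Qed.

End FiniteSums.

Section SmallSets.
Variables (R : realType) (W : omega1) (L : fundseq W).
Local Notation avg := (repavg R L).
Local Notation Sch := (schreier L).
Implicit Types (x : W) (M N P S : set nat) (F G : {fset nat}).

(** The first element of [N] is left free because the induction at a limit ordinal
    thins [S] only after a first element $l$, and with it the ordinal $\xi_l$, has
    been chosen. *)
Definition almost_disjoint_averages x S :=
  forall N, infsub posnat N -> (forall m, N m -> (nat_min N < m)%N -> S m) ->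
  forall G, Sch x G -> forall n,
  \sum_(0 <= i < n) \sum_(m <- G) avg x N i.+1 m <= 3.

(** The factor 12 makes the masses decay geometrically in
    [almost_disjoint_lim], where the i-th of them is at most $6/12^i\le2^{-i}$. *)
Definition sparse S := forall k m, S k -> S m -> (k < m)%N -> (12 * k <= m)%N.

Lemma almost_disjoint_sub x S P :
  almost_disjoint_averages x S -> P `<=` S -> almost_disjoint_averages x P.
Proof. by move=> adS PS N NP NS; apply: adS => // m Nm /(NS m Nm)/PS. Qed.

Lemma exists_sparse M : infinite_set M -> exists2 S, infsub M S & sparse S.
Proof.
move=> iM.
have [||S SM [_ Q]] := fusion iM (Q := fun n P => forall m, P m -> (12 * n <= m)%N).
- by move=> n N P QN [PN _] m /PN/QN.
- move=> n N [_ iN]; exists (tail N (12 * n)); first exact: tail_infsub.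
  by move=> m [_ /ltnW].
by exists S => // k m Sk Sm km; apply: (Q k).
Qed.

Lemma mass_ge0 x N i (s : seq nat) : infsub posnat N ->
  0 <= \sum_(m <- s) avg x N i.+1 m.
Proof.
by move=> NP; have [b xb] := repavg_blocks R L x NP; apply: sumr_ge0 => m _; exact: (block_ge0 xb).
Qed.

Lemma almost_disjoint_zero x : is_zero x -> almost_disjoint_averages x setT.
Proof.
move=> x0 N NP _ G SG; apply: sum_le3 => [i|i0 n].
  rewrite mass_ge0 //=; have [b xb] := repavg_blocks R L x NP.
  exact: block_mass_le1 xb.
have [b xb] := repavg_blocks R L x NP.
move: SG; rewrite schreier0E // => -[->|[k k0 ->]]; first by rewrite big_nil ltxx.
have fsetE (a : nat -> R) : \sum_(m <- [fset k]%fset) a m = a k by rewrite big_seq_fset1.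
rewrite fsetE => /gt_eqF/negbT/(block_supp xb)[_ /andP[_ kb]].
rewrite big_nat big1 // => i /andP[ii0 _]; rewrite fsetE; apply/eqP/negPn/negP.
move=> /(block_supp xb)[_ /andP[bk _]].
move: bk; rewrite ltnNge => /negP; apply; apply: leq_trans kb _.
by apply: increasing_le (block_increasing xb) _; exact: ltnW.
Qed.

(** A set of $\mathcal S_{\zeta+1}$ that first meets block $i_0$ consists of $p$
    sets of $\mathcal S_\zeta$, with $p$ at most its smallest element.  From block
    $i_0+2$ on, each block averages at least $12p$ of the $\zeta_j$, whereas the
    total mass of the $p$ pieces under all the $\zeta_j$ is at most $3p$. *)
Lemma almost_disjoint_succ x S : S `<=` posnat -> sparse S ->
  almost_disjoint_averages x S -> almost_disjoint_averages (osucc x) S.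
Proof.
move=> Spos spS adS N NP NS G SG.
have [b xb] := repavg_blocks R L x NP; have ub := block_averages_succ NP xb.
have binc := block_increasing xb.
rewrite repavgSE.
pose w j := \sum_(m <- G) avg x N j m.
pose k n := block_start (avg x) N n.+1.
pose s n := block_size (avg x) N n.+1.
have w0 j : 0 <= w j.+1 by exact: mass_ge0.
have kS n : k n.+1 = (k n + s n)%N by [].
have s0 n : (0 < s n)%N by exact: (block_size_gt0 NP xb).
have blockE n : \sum_(m <- G) avg_succ (avg x) N n.+1 m =
    (s n)%:R^-1 * \sum_((k n).+1 <= j < (k n.+1).+1) w j.
  by rewrite /avg_succ -mulr_sumr exchange_big.
apply: sum_le3 => [i|i0 n].
  rewrite (block_mass_le1 _ _ ub) andbT; apply: sumr_ge0 => m _; exact: (block_ge0 ub).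
move=> v0.
have [g Gg gi0] : exists2 g, g \in G & avg_succ (avg x) N i0.+1 g != 0.
  apply: contrapT => nex; move: v0; rewrite big_seq big1 ?ltxx // => m Gm.
  by apply/eqP/negPn/negP => nz; apply: nex; exists m.
move: SG; rewrite schreierSE => /schreier_succP[G0|]; first by rewrite G0 in Gg.
move=> p [H [p0 HS _ pG GE]].
have sN j : N (s j) /\ (b (k j) < s j)%N.
  by have /= /(block_supp xb)[? /andP[]] := block_min_supp xb (k j).
have [Ng /andP[_ gb]] := (block_supp ub _ _).1 gi0.
have gs j : (i0 < j)%N -> (g < s j)%N.
  move=> ij; apply: leq_ltn_trans gb (leq_ltn_trans _ (sN j).2).
  exact: (increasing_le (block_increasing ub)).
have minN : (nat_min N <= g)%N by apply: (nat_minP _).2 => //; exists g.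
have Ss j : (i0 < j)%N -> S (s j).
  by move=> ij; apply: NS; [exact: (sN j).1|exact: leq_ltn_trans minN (gs j ij)].
have sinc j : (s j < s j.+1)%N.
  apply: leq_ltn_trans (sN j.+1).2.
  have /(block_supp xb)[_ /andP[_]] := block_min_supp xb (k j).
  move=> h; apply: leq_trans h _; apply: increasing_le => //.
  by rewrite kS -addn1 leq_add2l.
have sp j : (i0.+2 <= j)%N -> (12 * p <= s j)%N.
  move=> ij; have lt : (s i0.+1 < s j)%N by exact: increasingP.
  apply: leq_trans (spS _ _ (Ss _ (ltnSn i0)) (Ss j (ltnW ij)) lt).
  by rewrite leq_mul2l /=; apply: leq_trans (pG g Gg) _; apply: ltnW; exact: gs.
have w_total K : \sum_(0 <= j < K) w j.+1 <= 3 * p%:R.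
  apply: (@le_trans _ _ (\sum_(0 <= j < K) \sum_(q <- index_iota 1 p.+1) \sum_(m <- H q) avg x N j.+1 m)).
    apply: ler_sum => j _; apply: sum_cover; first exact: fset_uniq.
      exact: (block_ge0 xb).
    by move=> m /GE[q qp Hm] _; exists q => //; rewrite mem_index_iota ltnS.
  rewrite exchange_big /= big_nat.
  apply: (@le_trans _ _ (\sum_(1 <= q < p.+1) 3)).
    rewrite [leRHS]big_nat; apply: ler_sum => q; rewrite ltnS => qp.
    exact: adS (HS q qp) K.
  by rewrite big_const_nat subSS subn0 iter_addr_0 mulr_natr.
have tele m : \sum_(0 <= i < m) \sum_((k i).+1 <= j < (k i.+1).+1) w j =
    \sum_(0 <= j < k m) w j.+1.
  elim: m => [|m IH]; first by rewrite !big_geq.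
  rewrite big_nat_recr //= IH [RHS](big_cat_nat (n := k m)) ?kS ?leq_addr //=.
  by rewrite big_add1.
have block_ge0' i : 0 <= \sum_((k i).+1 <= j < (k i.+1).+1) w j.
  by rewrite big_nat; apply: sumr_ge0 => -[|j].
apply: (@le_trans _ _ ((12 * p)%:R^-1 * \sum_(0 <= j < k n) w j.+1)).
  rewrite -tele mulr_sumr.
  have [ni|i0n] := leqP n i0.+2.
    rewrite big_geq //; apply: sumr_ge0 => i _; apply: mulr_ge0 => //.
  rewrite [leRHS](big_cat_nat (n := i0.+2)) ?(ltnW i0n) //=.
  rewrite -[leLHS]add0r; apply: lerD.
    by apply: sumr_ge0 => i _; apply: mulr_ge0.
  rewrite !big_nat; apply: ler_sum => i /andP[ij _]; rewrite blockE.
  rewrite ler_wpM2r // lef_pV2 ?posrE ?ltr0n ?muln_gt0 //.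
  by rewrite ler_nat; exact: sp.
rewrite ler_pdivrMl ?ltr0n ?muln_gt0 // mulr1.
apply: le_trans (w_total _) _; rewrite natrM ler_wpM2r ?ler0n //.
by rewrite ler_nat.
Qed.

Lemma osucc_inj x y : osucc x = osucc y -> x = y.
Proof.
by move=> e; apply/eqP; rewrite eq_le !ltS_ord // -?e ?lt_osucc // e lt_osucc.
Qed.

(** Let $G\in\mathcal S_{\xi_p}$ with $p\le G$ first meet block $i_0$.  A later
    block that starts at $l$ uses $\xi_l=\zeta+1$ with $\xi_p\le\zeta$ and is
    the mean of $l$ averages of index $\zeta$.  Thinning after $l$ places $G$,
    apart from the point $l$, in $\mathcal S_\zeta$ and bounds its total mass by
    $3$; the point $l$ adds at most $3$, and the block gives $G$ at most $6/l$. *)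
Lemma almost_disjoint_lim x M : is_limit x -> infsub posnat M ->
    (forall y N, (y < x)%O -> infsub posnat N ->
       exists2 S, infsub N S & almost_disjoint_averages y S) ->
  exists2 S, infsub M S & almost_disjoint_averages x S.
Proof.
move=> xlim MP IH.
pose Q l P := (forall m, P m -> (12 * l <= m)%N) /\
  forall z, (0 < l)%N -> L x l = osucc z ->
    almost_disjoint_averages z P /\
    forall n F, (0 < n < l)%N -> Sch (L x n) F -> (forall m, m \in F -> P m) -> Sch z F.
have [||S SM [_ QS]] := fusion MP.2 (Q := Q).
- move=> l N P [Nl Qz] [PN _]; split=> [m /PN/Nl//|z l0 lz].
  have [adN thr] := Qz z l0 lz; split; first exact: almost_disjoint_sub PN.
  by move=> n F nl SF FP; apply: thr nl SF _ => m /FP/PN.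
- move=> l N MN; have NP := infsub_trans MP MN.
  have [l0|l0] := posnP l.
    by exists N; [exact: infsub_refl NP.2|split=> [m _|z]; rewrite l0 ?muln0].
  have [z lz] := fs_osucc L xlim l0.
  have [|P NP' adP] := IH z N _ NP.
    by apply: lt_trans (fs_lt L l xlim); rewrite lz; exact: lt_osucc.
  have /choice[thr thrP] : forall n, exists t, (0 < n < l)%N ->
      forall F, Sch (L x n) F -> le_fset t F -> Sch z F.
    move=> n; have [nl|] := pselect (0 < n < l)%N; last by move=> h; exists 0%N.
    have [|t tP] := @schreier_eventually_mono _ L z (L x n); last by exists t.
    by apply: ltS_ord; rewrite -lz; exact: fs_incr.
  (* Beyond [t] the set is sparse and above all the thresholds for [n < l]. *)
  pose t := maxn (12 * l) (\max_(n < l) thr n).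
  exists (tail P t); first exact: infsub_trans NP' (tail_infsub _ NP'.2).
  split=> [m [_ tm]|z' _].
    exact: leq_trans (leq_trans (leq_maxl _ _) (ltnW tm)).
  rewrite lz => /osucc_inj <-; split; first exact: almost_disjoint_sub (@tail_sub _ _).
  move=> n F nl SF FP; apply: (thrP n nl F SF) => m /FP[_ tm].
  have /andP[_ nl'] := nl.
  apply: leq_trans (leq_trans (leq_maxr _ _) (ltnW tm)).
  exact: (leq_bigmax (Ordinal nl')).
exists S => // N NP NS G SG.
rewrite repavg_limE //.
have [|b ub rem] := @block_averages_lim R (fun n => avg (L x n)) N NP.
  by move=> j N' _ NP'; exact: repavg_blocks.
pose l i := nat_min (tail N (b i)).
have tP i : infsub posnat (tail N (b i)) by exact: infsub_trans NP (tail_infsub _ NP.2).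
have lP i : N (l i) /\ (b i < l i)%N := (nat_minP (infinite_nonempty (tP i).2)).1.
apply: sum_le3 => [i|i0 n].
  rewrite (block_mass_le1 _ _ ub) andbT; apply: sumr_ge0 => m _; exact: (block_ge0 ub).
move=> v0.
have [g Gg gi0] : exists2 g, g \in G & avg_lim (fun n => avg (L x n)) N i0.+1 g != 0.
  apply: contrapT => nex; move: v0; rewrite big_seq big1 ?ltxx // => m Gm.
  by apply/eqP/negPn/negP => nz; apply: nex; exists m.
have [Ng /andP[_ gb]] := (block_supp ub _ _).1 gi0.
have minN : (nat_min N <= g)%N by apply: (nat_minP _).2 => //; exists g.
move: SG; rewrite schreier_limE // => -[G0|[p [p0 pG SG]]]; first by rewrite G0 in Gg.
have gl i : (i0 < i)%N -> (g < l i)%N.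
  move=> ij; apply: leq_ltn_trans gb (leq_ltn_trans _ (lP i).2).
  exact: (increasing_le (block_increasing ub)).
have Sl i : (i0 < i)%N -> S (l i).
  by move=> ij; apply: NS; [exact: (lP i).1|exact: leq_ltn_trans minN (gl i ij)].
have linc i : (l i < l i.+1)%N.
  apply: leq_ltn_trans (lP i.+1).2.
  have [m Mm /andP[bm mb]] := block_nonempty ub i.
  by apply: leq_trans mb; apply: (nat_minP _).2; [exists m|].
have lgrow d : (12 ^ d <= l (i0.+1 + d)%N)%N.
  elim: d => [|d IHd]; first by rewrite addn0; exact: leq_ltn_trans (leq0n g) (gl _ (ltnSn i0)).
  have Si : S (l (i0.+1 + d)%N) by apply: Sl; rewrite addSn ltnS leq_addr.
  rewrite expnS addnS; apply: (@leq_trans (12 * l (i0.+1 + d)%N)%N); first by rewrite leq_mul2l.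
  by apply: (QS _ Si).1; split=> //; apply: Sl; rewrite addSn ltnS leqW // leq_addr.
have small i : (i0.+2 <= i)%N ->
    \sum_(m <- G) avg_lim (fun n => avg (L x n)) N i.+1 m <= 6 / (l i)%:R.
  move=> i0i; have Si := Sl i (ltnW i0i).
  have l0 : (0 < l i)%N by apply: NP.1; exact: (lP i).1.
  have [z lz] := fs_osucc L xlim l0.
  have [adz thr] := (QS _ Si).2 z l0 lz.
  rewrite /avg_lim rem -/(l i) lz repavgSE.
  set T := tail N (b i); have TP : infsub posnat T by exact: tP.
  have [bz zb] := repavg_blocks R L z TP.
  have sE : block_size (avg z) T 1 = l i.
    by rewrite /block_size (block_min_suppE zb) (block0 zb) tail_pos //; exact: TP.1.
  rewrite /avg_succ sE -mulr_sumr mulrC ler_wpM2r // exchange_big /=.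
  have -> : block_start (avg z) T 1 = 0%N by [].
  rewrite add0n big_add1 /=.
  pose G' := [fset m in G | `[< T m >] && (l i < m)%N]%fset.
  have G'P m : m \in G' -> [/\ m \in G, T m & (l i < m)%N].
    by rewrite !inE => /and3P[? /asboolP ? ?].
  apply: (@le_trans _ _ (\sum_(0 <= j < l i) \sum_(F <- [:: [fset l i]%fset; G']) \sum_(m <- F) avg z T j.+1 m)).
    apply: ler_sum => j _; apply: sum_cover; first exact: fset_uniq.
      exact: (block_ge0 zb).
    move=> m Gm /(block_supp zb)[Tm _].
    have lm : (l i <= m)%N by apply: (nat_minP _).2 => //; exists m.
    move: lm; rewrite leq_eqVlt => /predU1P[<-|lm].
      by exists [fset l i]%fset; rewrite !inE ?eqxx.
    by exists G'; rewrite !inE ?eqxx ?orbT // Gm lm andbT; apply/asboolP.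
  have NT m : T m -> (nat_min T < m)%N -> tail S (l i) m.
    move=> [Nm bm] lm; split=> //; apply: NS => //.
    by apply: leq_ltn_trans minN _; exact: ltn_trans (gl i (ltnW i0i)) lm.
  rewrite exchange_big /= !big_cons big_nil addr0.
  have -> : 6 = 3 + 3 :> R by rewrite -natrD.
  apply: lerD; apply: adz => //; first exact: schreier1.
  apply: (thr p).
  - rewrite p0 /=; exact: leq_ltn_trans (pG g Gg) (gl i (ltnW i0i)).
  - by apply: schreier_sub SG _; apply/fsubsetP => m /G'P[].
  - by move=> m /G'P[_ Tm lm]; apply: NT.
have geom K : \sum_(0 <= d < K) (2^-1 : R) ^+ d.+1 <= 1 - 2^-1 ^+ K.
  elim: K => [|K IHK]; first by rewrite big_geq // expr0 subrr.
  by rewrite big_nat_recr //= !exprS; move: IHK; lra.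
rewrite -[i0.+2]add0n big_addn.
apply: (@le_trans _ _ (\sum_(0 <= d < n - i0.+2) (2^-1 : R) ^+ d.+1)); last first.
  by apply: le_trans (geom _) _; rewrite gerBl exprn_ge0 // invr_ge0.
apply: ler_sum => d _; apply: le_trans (small _ (leq_addl _ _)) _.
have lg := lgrow d.+1; rewrite addnS -addSn addnC in lg.
have l0 : (0 < l (d + i0.+2))%N by apply: leq_trans lg; rewrite expn_gt0.
rewrite ler_pdivrMr ?ltr0n // exprVn ler_pdivlMl ?exprn_gt0 //.
rewrite -!natrX -natrM ler_nat; apply: leq_trans lg.
rewrite (_ : 12%N = (2 * 6)%N) // expnMn leq_mul2l; apply/orP; right.
by rewrite expnS leq_pmulr // expn_gt0.
Qed.

Theorem exists_almost_disjoint x M : infsub posnat M ->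
  exists2 S, infsub M S & almost_disjoint_averages x S.
Proof.
elim/(@omega1_ind W): x M => [x x0|x IH|x xlim IH] M MP.
- exists M; first exact: infsub_refl MP.2.
  by apply: almost_disjoint_sub (almost_disjoint_zero x0) _.
- have [S SM adS] := IH M MP; have [P PS spP] := exists_sparse SM.2.
  exists P; first exact: infsub_trans PS.
  apply: almost_disjoint_succ => //; last exact: almost_disjoint_sub PS.1.
  by move=> m /PS.1/SM.1/MP.1.
- apply: almost_disjoint_lim => // y N yx NP; exact: IH.
Qed.

End SmallSets.

(** * Covering by Schreier sets, or containing them *)

Section Dichotomy.
Variables (W : omega1) (L : fundseq W) (xi : W).
Implicit Types (F G : {fset nat}) (M N : set nat) (D : set {fset nat}).

Definition covered k F := exists G : nat -> {fset nat},
  (forall i, schreier L xi (G i)) /\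
  forall m, m \in F -> exists2 i, (i < k)%N & m \in G i.

Lemma covered_leq j k F : (j <= k)%N -> covered j F -> covered k F.
Proof.
move=> jk [G [GS FG]]; exists G; split=> // m /FG[i ij mG].
by exists i => //; exact: leq_trans jk.
Qed.

Lemma covered_sub k F G : covered k F -> (G `<=` F)%fset -> covered k G.
Proof. by move=> [H [HS FH]] GF; exists H; split=> // m /(fsubsetP GF)/FH. Qed.

Lemma elt_tail_min M n : infinite_set M ->
  elt (tail M (nat_min M)) n.+1 = elt M n.+2.
Proof. by move=> iM; rewrite -setD_min // /elt /= -iterSr. Qed.

Lemma seq_fsetE (s : seq nat) F : (forall m, (m \in s) = (m \in F)) ->
  [fset m in s]%fset = F.
Proof. by move=> sF; apply/fsetP => m; rewrite !inE sF. Qed.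

(** If, for each [k], thinning puts all the sets covered by [k] sets of
    $\mathcal S_\xi$ into [D], a diagonal set puts $\mathcal S_{\xi+1}$ into [D].
    Otherwise Galvin's lemma, for the sets covered by [k] that are not in [D],
    gives [N] all of whose infinite subsets have such an initial segment.  Extend
    $F\in D$ inside [N] by elements above it: by heredity of [D], the segment
    cannot lie within $F$, so it contains $F$. *)
Lemma covered_dichotomy D M : infsub posnat M ->
    (forall F G, D F -> (G `<=` F)%fset -> D G) ->
  (exists2 N, infsub M N & schreier_on L (osucc xi) N `<=` D) \/
  (exists k, exists2 N, infsub M N &
     forall F, D F -> [set` F] `<=` N -> covered k F).
Proof.
move=> MP hered.
pose P k N := forall F, [set` F] `<=` N -> covered k F -> D F.
have [dense|] := pselect (forall k N, infsub M N -> exists2 N', infsub N N' & P k N').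
  left; have [|N NM [_ QN]] := fusion MP.2 (Q := P) _ dense.
    by move=> k N N' PN [N'N _] F FN'; apply: PN => m /FN'/N'N.
  have NP := infsub_trans MP NM.
  (* Dropping the first element shifts the enumeration: the elements of index
     at least [p] lie strictly above the p-th element of [N]. *)
  exists (tail N (nat_min N)); first exact: infsub_trans (tail_infsub _ NM.2).
  move=> _ [F SF <-].
  have [->|/eqP F0] := eqVneq F fset0.
    apply: (QN _ (elt_in NP (ltnSn 0))); last first.
      by exists (fun=> fset0); split=> [i|m /imfsetP[]//]; exact: schreier_fset0.
    by move=> m /= /imfsetP[].
  move: SF; rewrite schreierSE => /schreier_succP/(_ F0)[p [G [p0 GS _ pF FE]]].
  apply: (QN _ (elt_in NP p0)).
    move=> m /= /imfsetP[i /= Fi ->]; have pi := pF i Fi.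
    case: i pi {Fi} => [|i] pi; first by move: p0; rewrite ltnNge pi.
    rewrite elt_tail_min ?NP.2 //; last exact: NP.2.
    split; first exact: elt_in.
    by apply: elt_lt => //; rewrite p0.
  apply: (@covered_leq p); first exact: elt_ge.
  pose h i := elt (tail N (nat_min N)) i.
  have TP : infsub posnat (tail N (nat_min N)).
    exact: infsub_trans NP (tail_infsub _ NP.2).
  exists (fun q => if (q < p)%N then [fset h i | i in G q.+1]%fset else fset0); split=> [q|m].
    case: ifP => qp; last exact: schreier_fset0.
    have Gq : schreier L xi (G q.+1) by exact: GS.
    apply: (schreier_spread Gq) => [i j Gi Gj ij|i _]; last exact: elt_ge.
    by apply: elt_lt => //; rewrite ij (schreier_pos Gq Gi).
  move=> /imfsetP[i /= /FE[[//|q] /andP[_ qp] Gi] ->]; exists q => //.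
  by rewrite qp; apply/imfsetP; exists i.
move=> /existsNP[k /existsNP[M' /not_implyP[MM' nP]]]; right; exists k.
pose B (s : seq nat) := covered k [fset m in s]%fset /\ ~ D [fset m in s]%fset.
have [N NM' [good|bad]] := galvin B MM'.2.
  case: nP; exists N => // F FN cF; apply: contrapT => nD.
  have sF : [fset m in sort leq F]%fset = F.
    by apply: seq_fsetE => m; rewrite mem_sort.
  apply: (good (sort leq F)); last by rewrite /B sF.
    have := sort_sorted leq_total F; rewrite !ltn_sorted_uniq_leq sort_uniq fset_uniq.
    by move=> ->.
  by move=> m; rewrite mem_sort => /FN.
have NM := infsub_trans MM' NM'; have NP := infsub_trans MP NM.
exists N => // F DF FN.
pose b := (\max_(m <- F) m)%N.
have Fb m : m \in F -> (m <= b)%N by move=> Fm; exact: leq_bigmax_seq.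
pose N' := [set m | m \in F \/ tail N b m].
have N'N : infsub N N'.
  split=> [m [/FN//|[]//]|]; apply/infinite_natP => n.
  have [m Tm nm] := (infinite_natP _).1 (tail_infinite (n := b) NP.2) n.
  by exists m => //; right.
have N'P := infsub_trans NP N'N.
have [||n [cI nD]] := bad (fun i => elt N' i.+1).
- exact: elt_increasing.
- by move=> i; apply: N'N.1; exact: elt_in.
apply: covered_sub cI _; apply/fsubsetP => m Fm; apply: contrapT => nI.
have [[//|j] _ ej] := elt_onto N'P (or_introl Fm : N' m).
have nj : (n <= j)%N.
  rewrite leqNgt; apply/negP => jn; apply: nI; rewrite !inE /=.
  by apply/mapP; exists j; rewrite ?mem_iota.
apply: nD; apply: hered DF _; apply/fsubsetP => i; rewrite !inE /= => /mapP[q].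
rewrite mem_iota add0n => /andP[_ qn] ->.
have lt : (elt N' q.+1 < m)%N by rewrite -ej; apply: elt_lt => //=; rewrite ltnS (leq_trans qn).
have [//|[_ bq]] := elt_in N'P (ltn0Sn q).
by have := ltn_trans bq lt; rewrite ltnNge Fb.
Qed.

End Dichotomy.

(** * The Hahn-Banach theorem *)

Section HahnBanach.
Variables (R : realType) (X : completeNormedModType R).
Implicit Types (q : X -> R) (C : set (X * R)).

Definition sublinear q :=
  (forall x y, q (x + y) <= q x + q y) /\
  (forall t x, 0 <= t -> q (t *: x) <= t * q x).

Definition convex_cone C :=
  [/\ C (0, 0), forall c d, C c -> C d -> C (c.1 + d.1, c.2 + d.2) &
      forall t c, 0 <= t -> C c -> C (t *: c.1, t * c.2)].

(** The largest sublinear minorant $p$ of $q$ with $p(-z)\le-s$ for all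
    $(z,s)\in C$: a linear functional below it takes at least the value $s$ at
    $z$. *)
Definition cone_inf q C (x : X) : R := inf [set q (x + c.1) - c.2 | c in C].

Lemma sublinear0 q : sublinear q -> q 0 = 0.
Proof.
move=> [subD subZ]; apply/eqP; rewrite eq_le; apply/andP; split.
  by have := subZ 0 0 (lexx _); rewrite scale0r mul0r.
by have := subD 0 0; rewrite addr0 -subr_ge0 addrK.
Qed.

Lemma sublinear_ge q x : sublinear q -> - q (- x) <= q x.
Proof.
move=> qs; rewrite -subr_ge0 opprK -(sublinear0 qs) -[X in q X](subrr x).
exact: qs.1.
Qed.

Section ConeInf.
Variables (q : X -> R) (C : set (X * R)).
Hypotheses (qs : sublinear q) (coneC : convex_cone C)
  (dom : forall c, C c -> c.2 <= q c.1).

Let lower x c : C c -> - q (- x) <= q (x + c.1) - c.2.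
Proof.
move=> Cc; have := qs.1 (x + c.1) (- x); rewrite addrAC subrr add0r.
have := dom Cc; lra.
Qed.

Let has_inf_cone x : has_inf [set q (x + c.1) - c.2 | c in C].
Proof.
split; first by have [C0 _ _] := coneC; exists (q (x + 0) - 0); exists (0, 0).
by exists (- q (- x)) => _ [c Cc <-]; exact: lower.
Qed.

Lemma cone_inf_le x c : C c -> cone_inf q C x <= q (x + c.1) - c.2.
Proof. by move=> Cc; apply: ge_inf; [exact: (has_inf_cone x).2|exists c]. Qed.

Lemma cone_inf_le_self x : cone_inf q C x <= q x.
Proof.
have [C0 _ _] := coneC.
by have := cone_inf_le x C0; rewrite addr0 subr0.
Qed.

Lemma le_cone_inf x r : (forall c, C c -> r <= q (x + c.1) - c.2) ->
  r <= cone_inf q C x.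
Proof.
move=> rC; apply: lb_le_inf; first exact: (has_inf_cone x).1.
by move=> _ [c Cc <-]; exact: rC.
Qed.

Lemma cone_inf_opp c : C c -> cone_inf q C (- c.1) <= - c.2.
Proof.
by move=> /(cone_inf_le (- c.1)); rewrite addNr sublinear0 // add0r.
Qed.

Lemma cone_inf_sublinear : sublinear (cone_inf q C).
Proof.
have [C0 CD CZ] := coneC; split=> [x y|t x].
  rewrite -lerBlDr; apply: le_cone_inf => c Cc.
  rewrite lerBlDr -lerBlDl; apply: le_cone_inf => d Cd.
  rewrite lerBlDl; apply: le_trans (cone_inf_le _ (CD _ _ Cc Cd)) _ => /=.
  by have := qs.1 (x + c.1) (y + d.1); rewrite addrACA; lra.
rewrite le_eqVlt => /predU1P[<-|t0].
  rewrite scale0r mul0r; apply: le_trans (cone_inf_le_self _) _.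
  by rewrite sublinear0.
rewrite -ler_pdivrMl //; apply: le_cone_inf => c Cc.
rewrite ler_pdivrMl //; apply: le_trans (cone_inf_le _ (CZ t _ (ltW t0) Cc)) _ => /=.
by rewrite -scalerDr mulrBr lerD2r qs.2 // ltW.
Qed.

End ConeInf.

(** Zorn's lemma: the pointwise infimum of a chain of sublinear functionals below
    [p] is finite, since each is at least $-p(-x)$ at $x$, and sublinear. *)
Lemma minimal_sublinear p : sublinear p -> exists q,
  [/\ sublinear q, forall x, q x <= p x &
      forall r, sublinear r -> (forall x, r x <= q x) -> r = q].
Proof.
move=> ps.
pose T := {q : X -> R | sublinear q /\ forall x, q x <= p x}.
pose le (q r : T) := `[< forall x, sval r x <= sval q x >].
have [||||[q [qs qp]] qmin] := @Zorn T le.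
- by move=> q; apply/asboolP.
- move=> q r s /asboolP qr /asboolP rs; apply/asboolP => x.
  exact: le_trans (rs x) (qr x).
- move=> [q Pq] [r Pr] /asboolP/= rq /asboolP/= qr; apply: eq_exist.
  by apply/funext => x; apply/eqP; rewrite eq_le rq qr.
- move=> A totA; have [[q0 Aq0]|A0] := pselect (A !=set0); last first.
    by exists (exist _ p (conj ps (fun x => lexx (p x)))) => q Aq; case: A0; exists q.
  pose S x := [set sval q x | q in (A : set T)].
  have infS x : has_inf (S x).
    split; first by exists (sval q0 x); exists q0.
    exists (- p (- x)) => _ [[q [qs qp]] _ <-] /=.
    by apply: le_trans (sublinear_ge x qs); rewrite lerN2.
  pose r x := inf (S x).
  have r_le (q : T) x : A q -> r x <= sval q x.
    by move=> Aq; apply: ge_inf; [exact: (infS x).2|exists q].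
  have le_r x c : (forall q : T, A q -> c <= sval q x) -> c <= r x.
    move=> cA; apply: lb_le_inf; first exact: (infS x).1.
    by move=> _ [q Aq <-]; exact: cA.
  have rs : sublinear r.
    split=> [x y|t x].
      rewrite -lerBlDr; apply: (le_r _ _) => q Aq; rewrite lerBlDr -lerBlDl.
      apply: (le_r _ _) => q' Aq'; rewrite lerBlDl.
      have [/asboolP|/asboolP] := totA _ _ Aq Aq' => qq'.
      - apply: le_trans (r_le _ _ Aq') _.
        by apply: le_trans ((svalP q').1.1 x y) _; rewrite lerD2r.
      - apply: le_trans (r_le _ _ Aq) _.
        by apply: le_trans ((svalP q).1.1 x y) _; rewrite lerD2l.
    rewrite le_eqVlt => /predU1P[<-|t0].
      rewrite scale0r mul0r; apply: le_trans (r_le _ _ Aq0) _.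
      by rewrite (sublinear0 (svalP q0).1).
    rewrite -ler_pdivrMl //; apply: (le_r _ _) => q Aq; rewrite ler_pdivrMl //.
    by apply: le_trans (r_le _ _ Aq) _; apply: (svalP q).1.2; exact: ltW.
  have rp x : r x <= p x by apply: le_trans (r_le _ _ Aq0) _; exact: (svalP q0).2.
  exists (exist _ r (conj rs rp)) => q Aq; apply/asboolP => x /=; exact: r_le.
exists q; split=> // r rs rq.
have rp x : r x <= p x by apply: le_trans (rq x) (qp x).
have := qmin (exist _ r (conj rs rp)); rewrite /le /=.
by move=> h; have /(congr1 sval) := h (introT (asboolP _) rq).
Qed.

(** A minimal sublinear functional $q$ is linear.  Lowering it along the ray of
    $(y,q(y))$ changes nothing, by minimality, while the lowered functional is at
    most $-q(y)$ at $-y$; hence $q$ is odd, and an odd sublinear functional is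
    additive. *)
Lemma hahn_banach p : sublinear p ->
  exists2 f : {linear X -> R^o}, True & forall x, f x <= p x.
Proof.
move=> /minimal_sublinear[q [qs qp qmin]].
have coneY y : convex_cone [set (t *: y, t * q y) | t in [set t | 0 <= t]].
  split.
  - by exists 0 => /=; rewrite ?scale0r ?mul0r.
  - move=> _ _ [t t0 <-] [s s0 <-] /=; exists (t + s); first exact: addr_ge0.
    by rewrite scalerDl mulrDl.
  - move=> s _ s0 [t t0 <-] /=; exists (s * t); first exact: mulr_ge0.
    by rewrite scalerA mulrA.
have domY y c : [set (t *: y, t * q y) | t in [set t | 0 <= t]] c -> c.2 <= q c.1.
  move=> [t t0 <-] /=; move: t0; rewrite /= le_eqVlt => /predU1P[<-|t0].
    by rewrite scale0r mul0r sublinear0.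
  rewrite -ler_pdivlMl //; have := qs.2 t^-1 (t *: y).
  by rewrite scalerA mulVf ?gt_eqF // scale1r; apply; rewrite invr_ge0 ltW.
have qN y : q (- y) = - q y.
  apply/eqP; rewrite eq_le; apply/andP; split; last first.
    by rewrite -{1}[y]opprK; exact: sublinear_ge.
  have := qmin _ (cone_inf_sublinear qs (coneY y) (@domY y)).
  move=> /(_ (cone_inf_le_self qs (coneY y) (@domY y))) <-.
  have -> : - cone_inf q [set (t *: y, t * q y) | t in [set t | 0 <= t]] y = - q y.
    have := qmin _ (cone_inf_sublinear qs (coneY y) (@domY y)).
    by move=> /(_ (cone_inf_le_self qs (coneY y) (@domY y))) ->.
  apply: (@cone_inf_opp _ _ qs (coneY y) (@domY y) (y, q y)).
  by exists 1 => /=; rewrite ?scale1r ?mul1r.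
have qD x y : q (x + y) = q x + q y.
  apply/eqP; rewrite eq_le qs.1 /=.
  by have := qs.1 (- x) (- y); rewrite -opprD !qN -opprD lerN2.
have qZ t x : q (t *: x) = t * q x.
  wlog t0 : t / 0 < t.
    move=> wl; case: (ltgtP 0 t) => [/wl//|t0|<-]; last first.
      by rewrite scale0r mul0r sublinear0.
    have := wl (- t); rewrite oppr_gt0 => /(_ t0).
    by rewrite scaleNr qN mulNr => /oppr_inj.
  apply/eqP; rewrite eq_le (qs.2 _ _ (ltW t0)) /=.
  rewrite -ler_pdivlMl //; have := qs.2 t^-1 (t *: x).
  by rewrite scalerA mulVf ?gt_eqF // scale1r; apply; rewrite invr_ge0 ltW.
have lin : linear (q : X -> R^o) by move=> t x y; rewrite qD qZ.
pose F : {linear X -> R^o} :=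
  HB.pack (q : X -> R^o) (GRing.isLinear.Build R X R^o *:%R q lin).
by exists F.
Qed.

Lemma dual_ballP (f : {linear X -> R^o}) :
  dual_ball f <-> forall x, `|f x| <= `|x|.
Proof.
split=> [[fc f1] x|fle].
  have [->|x0] := eqVneq x 0; first by rewrite linear0 !normr0.
  have /linear_boundedP/pinfty_ex_gt0[r r0 fr] : bounded_near f (nbhs (0 : X)).
    exact/linear_bounded_continuous.
  have nx0 : 0 < `|x| by rewrite normr_gt0.
  have fx : `|x|^-1 * `|f x| <= 1.
    have -> : `|x|^-1 * `|f x| = `|f (`|x|^-1 *: x)|.
      by rewrite linearZ normrZ gtr0_norm ?invr_gt0.
    apply: le_trans f1; apply: ub_le_sup.
      exists r => _ [v /= v1 <-]; apply: le_trans (fr v) _.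
      by rewrite -[leRHS]mulr1 ler_pM2l.
    by exists (`|x|^-1 *: x) => //=; rewrite normrZ gtr0_norm ?invr_gt0 // mulVf ?gt_eqF.
  by move: fx; rewrite ler_pdivrMl // mulr1.
split.
  apply: bounded_linear_continuous; apply/linear_boundedP.
  apply: filterS (nbhs_pinfty_ge (num_real (1 : R))) => r r1 x.
  by apply: le_trans (fle x) _; rewrite ler_peMl.
apply: ge_sup; first by exists `|f 0|, 0 => //=; rewrite normr0.
by move=> _ [v /= v1 <-]; apply: le_trans v1.
Qed.

(** Lower the norm along $C$ and take a linear functional below the result. *)
Lemma dual_ball_cone C : convex_cone C -> (forall c, C c -> c.2 <= `|c.1|) ->
  exists2 f : {linear X -> R^o}, dual_ball f & forall c, C c -> c.2 <= f c.1.
Proof.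
move=> coneC dom.
have ns : sublinear (fun x : X => `|x|).
  by split=> [x y|t x t0]; [exact: ler_normD|rewrite normrZ ger0_norm].
have [f _ fp] := hahn_banach (cone_inf_sublinear ns coneC dom).
exists f => [|c Cc]; last first.
  rewrite -lerN2 -linearN; apply: le_trans (fp _) _; exact: cone_inf_opp.
apply/dual_ballP => x; rewrite ler_norml; apply/andP; split.
  rewrite lerNl -linearN; apply: le_trans (fp _) _.
  by apply: le_trans (cone_inf_le_self ns coneC dom _) _; rewrite normrN.
by apply: le_trans (fp _) _; exact: cone_inf_le_self.
Qed.

Lemma norming_functional x :
  exists2 f : {linear X -> R^o}, dual_ball f & `|x| <= f x.
Proof.
pose C : set (X * R) := [set (t *: x, t * `|x|) | t in [set t | 0 <= t]].
have [||f fB fC] := @dual_ball_cone C.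
- split.
  + by exists 0 => /=; rewrite ?scale0r ?mul0r.
  + move=> _ _ [t t0 <-] [s s0 <-] /=; exists (t + s); first exact: addr_ge0.
    by rewrite scalerDl mulrDl.
  + move=> s _ s0 [t t0 <-] /=; exists (s * t); first exact: mulr_ge0.
    by rewrite scalerA mulrA.
- by move=> _ [t t0 <-] /=; rewrite normrZ ger0_norm.
exists f => //; apply: (fC (x, `|x|)); exists 1 => /=; rewrite ?scale1r ?mul1r //.
Qed.

(** Compactness of the dual ball.  For a finite combination
    $z=\sum t_iy_i$ with $t_i\ge0$, a functional that works for the $y_i$ shows
    $\varepsilon\sum t_i\le\|z\|$; the pairs $(z,\varepsilon\sum t_i)$ form a
    cone to which [dual_ball_cone] applies. *)
Lemma dual_ball_compact (Y : set X) (eps : R) :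
    (forall s : seq X, (forall y, y \in s -> Y y) ->
      exists2 f : {linear X -> R^o}, dual_ball f & forall y, y \in s -> eps <= f y) ->
  exists2 f : {linear X -> R^o}, dual_ball f & forall y, Y y -> eps <= f y.
Proof.
move=> fin.
pose good (r : seq (R * X)) := forall c, c \in r -> 0 <= c.1 /\ Y c.2.
pose comb (r : seq (R * X)) := (\sum_(c <- r) c.1 *: c.2, eps * \sum_(c <- r) c.1).
have [||f fB fC] := @dual_ball_cone [set comb r | r in good].
- split.
  + by exists [::] => //; rewrite /comb !big_nil mulr0.
  + move=> _ _ [r gr <-] [r' gr' <-]; exists (r ++ r').
      by move=> c; rewrite mem_cat => /orP[/gr|/gr'].
    by rewrite /comb !big_cat /= mulrDr.
  + move=> t _ t0 [r gr <-]; exists [seq (t * c.1, c.2) | c <- r].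
      by move=> _ /mapP[c /gr[c0 Yc] ->]; split=> //=; exact: mulr_ge0.
    rewrite /comb !big_map /=; congr pair; last by rewrite -mulr_sumr mulrCA.
    by rewrite scaler_sumr; apply: eq_bigr => c _; rewrite scalerA.
- move=> _ [r gr <-] /=.
  have [|f /dual_ballP f1 fr] := fin (map snd r).
    by move=> _ /mapP[c /gr[_ Yc] ->].
  apply: le_trans (f1 _); apply: le_trans (ler_norm _).
  rewrite linear_sum mulr_sumr big_seq [leRHS]big_seq.
  apply: ler_sum => c cr; rewrite linearZ /= mulrC; have [c0 _] := gr c cr.
  by rewrite ler_wpM2l // fr // map_f.
exists f => // y Yy; have := fC (comb [:: (1, y)]).
rewrite /comb !big_seq1 /= mulr1 scale1r; apply; exists [:: (1, y)].
  by move=> c; rewrite inE => /eqP->.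
by rewrite /comb !big_seq1 /= mulr1 scale1r.
Qed.

End HahnBanach.

(** * From large sequences to spreading models *)

Section Separation.
Variables (R : realType) (X : completeNormedModType R).
Implicit Types (x y : nat -> X) (v : X).

Lemma weakly_cvg_sub x v (h : nat -> nat) : (forall i, (i <= h i)%N) ->
  weakly_cvg x v -> weakly_cvg (x \o h) v.
Proof.
move=> hge xv f df; apply: (cvg_comp h (f \o x) _ (xv f df)).
move=> P [N _ NP]; exists N => // n /= Nn; apply: NP; exact: leq_trans Nn (hge n).
Qed.

Lemma weakly_cvg_sub0 x v : weakly_cvg x v -> weakly_cvg (fun n => x n - v) 0.
Proof.
move=> xv f df; rewrite linear0 -(subrr (f v)).
under eq_fun do rewrite linearB.
by apply: cvgB; [exact: xv|exact: cvg_cst].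
Qed.

Variable y : nat -> X.
Hypothesis y0 : weakly_cvg y 0.

Lemma weakly_null_lt (f : {linear X -> R^o}) eps (h : nat -> nat) :
  dual_ball f -> 0 < eps -> (forall i, (i <= h i)%N) -> exists i, f (y (h i)) < eps.
Proof.
move=> [df _] e0 hge; have := weakly_cvg_sub hge y0 df.
rewrite linear0 => /cvgrPdist_lt/(_ _ e0)[i _ /(_ i (leqnn i))] /=.
by rewrite sub0r normrN => h1; exists i; apply: le_lt_trans (ler_norm _) h1.
Qed.

(** If no interval of [N] after [a] were long enough, compactness would give one
    functional that is at least $\varepsilon$ at all $y_q$ with $q\in N$, $q>a$. *)
Lemma weakly_null_gap eps N a : 0 < eps -> infinite_set N -> exists p, [/\ N p, (a < p)%N &
  forall f : {linear X -> R^o}, dual_ball f ->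
    exists q, [/\ N q, (a < q < p)%N & f (y q) < eps]].
Proof.
move=> e0 iN; apply: contrapT => nogap.
have fin p : N p -> (a < p)%N -> exists2 f : {linear X -> R^o}, dual_ball f &
    forall q, N q -> (a < q < p)%N -> eps <= f (y q).
  move=> Np ap; apply: contrapT => nf; apply: nogap; exists p; split=> // f fB.
  apply: contrapT => nq; apply: nf; exists f => // q Nq aqp.
  by rewrite leNgt; apply/negP => fq; apply: nq; exists q.
have [s sY|f fB fN] := @dual_ball_compact _ _ [set y q | q in tail N a] eps.
  have [p Np sp] : exists2 p, tail N a p &
      forall z, z \in s -> exists q, [/\ N q, (a < q < p)%N & y q = z].
    elim: s sY => [|z s IH] sY.
      by have [p Np ap] := (infinite_natP N).1 iN a; exists p.
    have [|p [Np ap] sp] := IH; first by move=> u us; apply: sY; rewrite inE us orbT.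
    have [|q [Nq aq] qz] := sY z; first by rewrite inE eqxx.
    have [p' Np'] := (infinite_natP N).1 iN (maxn p q).
    rewrite gtn_max => /andP[pp' qp']; exists p'; first by split=> //; exact: ltn_trans pp'.
    move=> u; rewrite inE => /predU1P[->|/sp[q' [Nq' /andP[aq' q'p] q'u]]].
      by exists q; rewrite aq.
    by exists q'; rewrite aq' (ltn_trans q'p).
  have [f fB fp] := fin p Np.1 Np.2.
  by exists f => // z /sp[q [Nq aqp <-]]; exact: fp.
have iT : infinite_set (tail N a) by exact: tail_infinite.
have /choice[h hP] : forall i, exists m, tail N a m /\ (i <= m)%N.
  by move=> i; have [m Tm im] := (infinite_natP _).1 iT i; exists m; split=> //; exact: ltnW.
have [i] := weakly_null_lt fB e0 (fun i => (hP i).2).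
by rewrite ltNge fN //; exists (h i) => //; exact: (hP i).1.
Qed.

(** There is a longest initial segment of $(p_i)$ on which some functional of the
    ball is at least $c$; otherwise, by compactness, one would be so on all of
    it. *)
Lemma weakly_null_bounded_rank c (p : nat -> nat) : 0 < c -> (forall i, (i <= p i)%N) ->
  exists k, (exists2 f : {linear X -> R^o}, dual_ball f & forall i, (i < k)%N -> c <= f (y (p i)))
    /\ forall (f : {linear X -> R^o}) k', dual_ball f ->
         (forall i, (i < k')%N -> c <= f (y (p i))) -> (k' <= k)%N.
Proof.
move=> c0 pge.
pose P k := `[< exists2 f : {linear X -> R^o}, dual_ball f &
  forall i, (i < k)%N -> c <= f (y (p i)) >].
have Pex : exists k, P k.
  by exists 0%N; apply/asboolP; have [f fB _] := norming_functional (0 : X); exists f.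
have [K nK] : exists K, ~ P K.
  apply: contrapT => allP.
  have [s sY|f fB fN] := @dual_ball_compact _ _ (range (y \o p)) c.
    have [K sK] : exists K, forall z, z \in s -> exists2 i, (i < K)%N & y (p i) = z.
      elim: s sY => [|z s IH] sY; first by exists 0%N.
      have [|K sK] := IH; first by move=> u us; apply: sY; rewrite inE us orbT.
      have [|i _ iz] := sY z; first by rewrite inE eqxx.
      exists (maxn K i.+1) => u; rewrite inE => /predU1P[->|/sK[j jK ju]].
        by exists i => //; rewrite leq_maxr.
      by exists j => //; apply: leq_trans jK _; rewrite leq_maxl.
    have /asboolP[f fB fK] : P K by apply: contrapT => nP; apply: allP; exists K.
    by exists f => // z /sK[i iK <-]; exact: fK.
  have [i] := weakly_null_lt fB c0 pge.
  by rewrite ltNge fN //; exists i.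
have Pbnd k : P k -> (k <= K)%N.
  move=> /asboolP[f fB fk]; rewrite leqNgt; apply/negP => Kk; apply: nK.
  by apply/asboolP; exists f => // i iK; apply: fk; exact: ltn_trans Kk.
case: (ex_maxnP Pex Pbnd) => k /asboolP Pk kmax; exists k; split=> // f k' fB fk'.
by apply: kmax; apply/asboolP; exists f.
Qed.

(** Call an interlaced list $q_0<p_0<\cdots<q_{k-1}<p_{k-1}$ bad if the conclusion
    fails for it.  By Galvin's lemma, if bad lists cannot be avoided then every
    interlaced sequence in some [N] has a bad initial segment.  Choose the $p_i$
    so far apart that each functional of the ball drops below $\varepsilon$
    between any two of them, take a functional $f$ for the longest segment of
    $(p_i)$ that admits one, and only then choose the $q_i$ where $f$ is below
    $\varepsilon$.  Now $f$ shows that no initial segment is bad. *)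
Lemma weakly_null_separation c eps M : 0 < c -> 0 < eps -> infinite_set M ->
  exists2 N, infsub M N & forall k (q p : nat -> nat),
    (forall i, (i < k)%N -> [/\ N (q i), N (p i) & (q i < p i)%N]) ->
    (forall i, (i.+1 < k)%N -> (p i < q i.+1)%N) ->
    (exists2 f : {linear X -> R^o}, dual_ball f & forall i, (i < k)%N -> c <= f (y (p i))) ->
    exists2 g : {linear X -> R^o}, dual_ball g &
      forall i, (i < k)%N -> c <= g (y (p i)) /\ g (y (q i)) <= eps.
Proof.
move=> c0 e0 iM.
pose inter (q p : nat -> nat) j := if odd j then p j./2 else q j./2.
pose bad (s : seq nat) := exists k q p, [/\ s = mkseq (inter q p) k.*2,
  exists2 f : {linear X -> R^o}, dual_ball f & forall i, (i < k)%N -> c <= f (y (p i)) &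
  ~ exists2 g : {linear X -> R^o}, dual_ball g &
      forall i, (i < k)%N -> c <= g (y (p i)) /\ g (y (q i)) <= eps].
have [N NM [good|allbad]] := galvin bad iM; exists N => //.
  move=> k q p Nqp pq fk; apply: contrapT => ng.
  apply: (good (mkseq (inter q p) k.*2)); last by exists k, q, p.
    apply/(sortedP 0%N) => j; rewrite size_mkseq => jk.
    rewrite !nth_mkseq ?(ltnW jk) // /inter /= uphalf_half.
    have hk : (j./2 < k)%N by rewrite ltn_half_double ltnW.
    case: (boolP (odd j)) => oj /=; last by have [] := Nqp _ hk.
    rewrite add1n; apply: pq; rewrite -ltn_double doubleS.
    by move: jk; rewrite -{1}[j]odd_double_half oj.
  move=> i /mapP[j]; rewrite mem_iota add0n => /andP[_ jk] ->; rewrite /inter.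
  have hk : (j./2 < k)%N by rewrite ltn_half_double.
  by have [Nq Np _] := Nqp _ hk; case: ifP.
exfalso.
have /choice[gap gapP] := fun a => weakly_null_gap a e0 NM.2.
pose d i := iter i gap 0%N.
have dS i : d i.+1 = gap (d i) by [].
have dinc : increasing d by move=> i; rewrite dS; have [] := gapP (d i).
have dge i : (i <= d i.+1)%N by apply: leq_trans (increasing_ge _ dinc) (ltnW (dinc _)).
have [K [[f fB fK] Kmax]] := weakly_null_bounded_rank c0 dge.
have /choice[q qP] : forall i, exists q, [/\ N q, (d i < q < d i.+1)%N & f (y q) < eps].
  by move=> i; have [_ _ /(_ f fB)] := gapP (d i).
have [||n [k [q' [p' [eqe [f' f'B f'k] ng]]]]] := allbad (inter q (d \o succn)).
- move=> j; rewrite /inter /= uphalf_half; case: (odd j) => /=.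
    by rewrite add1n; have [_ /andP[]] := qP (j./2).+1.
  by have [_ /andP[]] := qP j./2.
- move=> j; rewrite /inter /=; case: ifP => _; first by have [] := gapP (d j./2).
  by have [] := qP j./2.
have nk : n = k.*2 by have := congr1 size eqe; rewrite !size_mkseq.
have eqpq i : (i < k)%N -> p' i = d i.+1 /\ q' i = q i.
  move=> ik; have := congr1 (fun s => nth 0%N s i.*2) eqe.
  have := congr1 (fun s => nth 0%N s i.*2.+1) eqe.
  rewrite nk !nth_mkseq ?ltn_double ?ltn_Sdouble // /inter /= odd_double /= uphalf_double.
  by rewrite doubleK.
have kK : (k <= K)%N.
  by apply: Kmax f'B _ => i ik; have := f'k i ik; rewrite (eqpq i ik).1.
apply: ng; exists f => // i ik; have [-> ->] := eqpq i ik; split.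
  by apply: fK; exact: leq_trans kK.
by have [_ _ /ltW] := qP i.
Qed.

End Separation.

Section SpreadingModel.
Variables (R : realType) (X : completeNormedModType R) (W : omega1) (L : fundseq W).

(** A functional that is at least $c$ where the coefficient is nonnegative and at
    most $\varepsilon$ elsewhere bounds the norm below by
    $\frac{c-\varepsilon}2\sum|\alpha_i|+\frac{c+\varepsilon}2\sum\alpha_i$.  Use
    this for $\alpha$ and for $-\alpha$. *)
Lemma spreading_model_of_signs (th : W) (y : nat -> X) c eps :
    (forall F (P : pred nat), schreier L th F ->
       exists2 g : {linear X -> R^o}, dual_ball g & forall i, i \in F ->
         if P i then c <= g (y i) else g (y i) <= eps) ->
  spreading_model L th y ((c - eps) / 2).
Proof.
move=> sep F alpha SF.
have half (beta : nat -> R) :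
    ((c - eps) * (\sum_(i <- F) `|beta i|) + (c + eps) * (\sum_(i <- F) beta i)) / 2 <=
    `|\sum_(i <- F) beta i *: y i|.
  have [g /dual_ballP g1 gF] := sep F (fun i => 0 <= beta i) SF.
  apply: le_trans (g1 _); apply: le_trans (ler_norm _).
  rewrite linear_sum !mulr_sumr -big_split mulr_suml /= big_seq [leRHS]big_seq.
  apply: ler_sum => i /gF; rewrite linearZ /= -[_ *: _]/(beta i * g (y i)).
  case: ifP => [b0 cg|/negbT]; first by rewrite ger0_norm //; nra.
  by rewrite -ltNge => b0 ge; rewrite ltr0_norm //; nra.
have := half (fun i => - alpha i).
under eq_bigr do rewrite normrN.
under [X in `|X|]eq_bigr do rewrite scaleNr.
rewrite !sumrN normrN; have := half alpha; lra.
Qed.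

(** In an enumeration $E$ of the separated set, the new sequence uses
    $E_{3t+1}$ for index $t$.  The neighbours serve as partners in an interlaced
    list: $E_{3t+1}$ is the $p$ of the pair $(E_{3t},E_{3t+1})$ if $t$ has a
    nonnegative coefficient, and the $q$ of $(E_{3t+1},E_{3t+2})$ if not.  One
    element $p$ for each $t\in F$ is a spread of $F$, hence again a Schreier
    set. *)
Lemma large_spreading_model (th : W) (A : set X) x v c eps :
    0 < c -> 0 < eps -> seq_in A x -> weakly_cvg x v -> large L th x v c ->
  exists x', [/\ seq_in A x', weakly_cvg x' v &
     spreading_model L th (fun n => x' n - v) ((c - eps) / 2)].
Proof.
move=> c0 e0 Ax xv [M MP big].
pose y n := x (elt M n) - v.
have y0 : weakly_cvg y 0.
  exact: weakly_cvg_sub (elt_ge MP) (weakly_cvg_sub0 xv).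
have [N NP sep] := weakly_null_separation y0 c0 e0 infinite_posnat.
pose E n := elt N n.+1.
have Einc : increasing E by exact: elt_increasing.
have NE n : N (E n) by exact: elt_in.
have Ege n : (n <= E n)%N by exact: increasing_ge.
exists (fun i => x (elt M (E (3 * i + 1)%N))); split.
- by move=> i _; apply: Ax; apply: MP.1; apply: elt_in => //; apply: NP.1.
- apply: (@weakly_cvg_sub _ _ x v (fun i => elt M (E (3 * i + 1)))) xv => i.
  apply: leq_trans (elt_ge MP _); apply: leq_trans (Ege _); lia.
apply: spreading_model_of_signs => F P SF.
pose h t := if P t then E (3 * t + 1)%N else E (3 * t + 2)%N.
pose h' t := if P t then E (3 * t)%N else E (3 * t + 1)%N.
pose s := sort leq F.
have sF i : (i < size s)%N -> nth 0%N s i \in F.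
  by move=> iF; rewrite -(mem_sort leq); exact: mem_nth.
have sinc i : (i.+1 < size s)%N -> (nth 0%N s i < nth 0%N s i.+1)%N.
  move=> iF; have := sort_sorted leq_total F.
  move=> /(sortedP 0%N)/(_ i iF) le; rewrite ltn_neqAle le andbT.
  by rewrite nth_uniq ?(ltnW iF) // ?sort_uniq ?fset_uniq // neq_ltn ltnSn.
have [|||g gB gs] := sep (size s) (fun i => h' (nth 0%N s i)) (fun i => h (nth 0%N s i)).
- move=> i iF; rewrite /h /h'; case: ifP => _; split=> //;
    apply: increasingP Einc _; lia.
- move=> i /sinc lt; rewrite /h /h'; case: ifP => _; case: ifP => _;
    apply: increasingP Einc _; lia.
- have hinc : {homo h : i j / (i < j)%N}.
    move=> i j ij; rewrite /h; case: ifP => _; case: ifP => _;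
    apply: increasingP Einc _; lia.
  have hge i : (i <= h i)%N.
    by rewrite /h; case: ifP => _; apply: leq_trans (Ege _); lia.
  have Sh := schreier_spread SF (fun i j _ _ => hinc i j) (fun i _ => hge i).
  have [|_ [f fB fh]] := big [fset elt M i | i in [fset h i | i in F]]%fset.
    by exists [fset h i | i in F]%fset.
  exists f => // i iF; apply: fh; apply/imfsetP; exists (h (nth 0%N s i)) => //.
  by apply/imfsetP; exists (nth 0%N s i) => //; exact: sF.
exists g => // i iF.
have is_ : i \in s by rewrite mem_sort.
have := gs (index i s); rewrite index_mem => /(_ is_); rewrite nth_index //.
by rewrite /h /h'; case: ifP => _ [].
Qed.

End SpreadingModel.

(** * Oscillation of Cesàro means *)

Section Oscillation.
Variables (R : realType) (X : completeNormedModType R).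
Implicit Types (x z w : nat -> X) (C c : R).

Definition bounded_by C x := forall n, (0 < n)%N -> `|x n| <= C.

Definition cesaro_mean z n : X := n%:R^-1 *: \sum_(1 <= i < n.+1) z i.

Lemma cesaro_bounded C z : bounded_by C z -> bounded_by C (cesaro_mean z).
Proof.
move=> zC n n0; rewrite /cesaro_mean normrZ ger0_norm ?invr_ge0 // ler_pdivrMl ?ltr0n //.
apply: le_trans (ler_norm_sum _ _ _) _; rewrite big_nat.
apply: (@le_trans _ _ (\sum_(1 <= i < n.+1) C)).
  by rewrite [leRHS]big_nat; apply: ler_sum => i /andP[i0 _]; exact: zC.
by rewrite big_const_nat subSS subn0 iter_addr_0 mulr_natl.
Qed.

Section Ca.
Variables (C : R) (w : nat -> X).
Hypothesis wC : bounded_by C w.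

Let D n := [set d | exists k l, [/\ (n <= k)%N, (n <= l)%N & d = `|w k - w l|]].

Let D_sup n : (0 < n)%N -> has_sup (D n).
Proof.
move=> n0; split; first by exists `|w n - w n|, n, n.
exists (2 * C) => _ [k [l [nk nl ->]]]; apply: le_trans (ler_normB _ _) _.
by rewrite mulr2n mulrDl mul1r lerD // wC // (leq_trans n0).
Qed.

Let D_ge0 n : (0 < n)%N -> 0 <= sup (D n).
Proof.
move=> n0; have [_ Dub] := D_sup n0.
by apply: ub_le_sup => //; exists n, n; rewrite subrr normr0.
Qed.

Lemma ca_ge0 : 0 <= ca w.
Proof.
apply: lb_le_inf; first by exists (sup (D 1)); exists 1%N.
by move=> _ [n n0 <-]; exact: D_ge0.
Qed.

Lemma ca_le : ca w <= 2 * C.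
Proof.
apply: (@le_trans _ _ (sup (D 1))).
  by apply: ge_inf; [exists 0 => _ [n n0 <-]; exact: D_ge0|exists 1%N].
apply: ge_sup; first exact: (D_sup (ltnSn 0)).1.
move=> _ [k [l [k1 l1 ->]]]; apply: le_trans (ler_normB _ _) _.
by rewrite mulr2n mulrDl mul1r lerD // wC.
Qed.

Lemma le_ca c : (forall n r, (0 < n)%N -> r < c ->
    exists k l, [/\ (n <= k)%N, (n <= l)%N & r < `|w k - w l|]) -> c <= ca w.
Proof.
move=> wc; apply: lb_le_inf; first by exists (sup (D 1)); exists 1%N.
move=> _ [n n0 <-]; rewrite leNgt; apply/negP => lt.
have [k [l [nk nl]]] := wc n _ n0 lt; rewrite ltNge => /negP; apply.
by apply: ub_le_sup; [exact: (D_sup n0).2|exists k, l].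
Qed.

Lemma lt_ca c n : c < ca w -> (0 < n)%N ->
  exists k l, [/\ (n <= k)%N, (n <= l)%N & c < `|w k - w l|].
Proof.
move=> cw n0; have : c < sup (D n).
  apply: lt_le_trans cw _; apply: ge_inf; last by exists n.
  by exists 0 => _ [m m0 <-]; exact: D_ge0.
by move=> /(sup_gt (D_sup n0).1)[_ [k [l [nk nl ->]]]] ?; exists k, l.
Qed.

End Ca.

Lemma l1_dotE (a : nat -> R) x T : (forall k, (T <= k)%N -> a k = 0) -> a 0%N = 0 ->
  l1_dot a x = \sum_(0 <= k < T) a k *: x k.
Proof.
move=> aT a0; apply: (@lim_near_cst X) => //; exists T.+1 => // n /= Tn.
have -> : \sum_(1 <= k < n) a k *: x k = \sum_(0 <= k < n) a k *: x k.
  by rewrite [RHS]big_ltn ?(leq_ltn_trans _ Tn) // a0 scale0r add0r.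
rewrite (big_cat_nat (n := T)) //=; last exact: ltnW.
rewrite [X in _ + X](_ : _ = 0) ?addr0 // big_nat big1 // => i /andP[/aT-> _].
by rewrite scale0r.
Qed.

Section Averages.
Variables (M : set nat) (u : nat -> nat -> R) (b : nat -> nat).
Hypotheses (MP : infsub posnat M) (ub : block_averages M u b).

Lemma avg_dotE x n T : (b n.+1 < T)%N ->
  l1_dot (u n.+1) x = \sum_(0 <= k < T) u n.+1 k *: x k.
Proof.
move=> bT; apply: l1_dotE => [k Tk|].
  apply/eqP/negPn/negP => /(block_supp ub)[_ /andP[_]].
  by rewrite leqNgt (leq_trans bT).
by apply/eqP/negPn/negP => /(block_supp ub)[/MP.1].
Qed.

Lemma avg_dot_sub x v n : l1_dot (u n.+1) (fun k => x k - v) = l1_dot (u n.+1) x - v.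
Proof.
rewrite !(avg_dotE _ (ltnSn _)); under eq_bigr do rewrite scalerBr.
by rewrite sumrB -scaler_suml (block_sum1 ub) // scale1r.
Qed.

Lemma avg_dot_bounded C x : bounded_by C x -> bounded_by C (fun n => l1_dot (u n) x).
Proof.
move=> xC [//|n] _; rewrite (avg_dotE _ (ltnSn _)).
apply: le_trans (ler_norm_sum _ _ _) _.
rewrite -[C]mul1r -(block_sum1 ub (ltnSn (b n.+1))) mulr_suml.
apply: ler_sum => k _; rewrite normrZ ger0_norm ?(block_ge0 ub) //.
have [->|] := eqVneq (u n.+1 k) 0; first by rewrite !mul0r.
move=> /(block_supp ub)[/MP.1 k0 _].
by rewrite ler_wpM2l ?(block_ge0 ub) // xC.
Qed.

Lemma cesaro_avg_sub x v n : (0 < n)%N ->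
  cesaro_mean (fun n => l1_dot (u n) (fun k => x k - v)) n =
  cesaro_mean (fun n => l1_dot (u n) x) n - v.
Proof.
move=> n0; rewrite /cesaro_mean !big_add1 /=.
under eq_bigr do rewrite avg_dot_sub.
rewrite sumrB scalerBr; congr (_ - _).
rewrite big_const_nat subn0 iter_addr_0 -[v *+ n]scaler_nat scalerA mulVf ?scale1r //.
by rewrite pnatr_eq0 -lt0n.
Qed.

End Averages.

End Oscillation.

(** * Oscillating averages give large sequences *)

Section Upper.
Variables (R : realType) (X : completeNormedModType R) (W : omega1) (L : fundseq W).
Variables (xi : W).

(** Suppose that the first alternative of [covered_dichotomy] fails for
    $\mathcal F_{c'}$.  Where a norming functional of a mean of norm above $c$ is
    at least $c'$, the mass is at least $(c-c')/C$, against the bound $3k/n$ for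
    sets covered by $k$ sets of $\mathcal S_\xi$. *)
Lemma large_of_averages (y : nat -> X) (M : set nat) (C c c' : R) :
    bounded_by C y -> infsub posnat M -> 0 < c' < c ->
    (forall N n0, infsub M N -> exists2 n, (n0 < n)%N &
       c < `|cesaro_mean (fun i => l1_dot (repavg R L xi N i) y) n|) ->
  exists2 N, infsub M N & schreier_on L (osucc xi) N `<=` big_family y c'.
Proof.
move=> yC MP /andP[c'0 c'c] big.
have [|//|[k [N NM DN]]] := covered_dichotomy L xi (D := big_family y c') MP.
  move=> F G [Fpos [f fB fF]] /fsubsetP GF; split; first by move=> m /GF/Fpos.
  by exists f => // m /GF/fF.
exfalso; have NP := infsub_trans MP NM.
have [S SN adS] := exists_almost_disjoint R L xi NP.
have SP := infsub_trans NP SN.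
have [b ub] := repavg_blocks R L xi SP.
have C0 : 0 <= C by apply: le_trans (yC 1%N isT).
have cc0 : 0 < c - c' by rewrite subr_gt0.
(* From this length on, $3k/n<(c-c')/C$. *)
pose n0 := Num.truncn (3 * k%:R * C / (c - c')).
have n0P : 3 * k%:R * C / (c - c') < n0.+1%:R by exact: truncnS_gt.
have [n n0n cn] := big S n0 (infsub_trans NM SN).
have npos : (0 < n)%N by exact: leq_ltn_trans n0n.
have [f fB fn] := norming_functional (cesaro_mean (fun i => l1_dot (repavg R L xi S i) y) n).
have {fn}cfn := lt_le_trans cn fn.
pose T := (b n).+1; pose a j := n%:R^-1 * \sum_(0 <= i < n) repavg R L xi S i.+1 j.
have a0 j : 0 <= a j.
  by rewrite mulr_ge0 ?invr_ge0 // sumr_ge0 // => i _; exact: (block_ge0 ub).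
have bT i : (i < n)%N -> (b i.+1 < T)%N.
  by move=> iN; rewrite ltnS; apply: increasing_le => //; exact: block_increasing ub.
have fE : f (cesaro_mean (fun i => l1_dot (repavg R L xi S i) y) n) =
    \sum_(0 <= j < T) a j * f (y j).
  have -> : cesaro_mean (fun i => l1_dot (repavg R L xi S i) y) n = \sum_(0 <= j < T) a j *: y j.
    rewrite /cesaro_mean big_add1 /= big_nat.
    under eq_bigr => i /andP[_ iN] do rewrite (avg_dotE SP ub _ (bT i iN)).
    rewrite -big_nat exchange_big scaler_sumr; apply: eq_bigr => j _.
    by rewrite -scaler_suml scalerA.
  by rewrite linear_sum; apply: eq_bigr => j _; rewrite linearZ.
have a1 : \sum_(0 <= j < T) a j = 1.
  rewrite -mulr_sumr exchange_big_nat /= big_nat.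
  under eq_bigr => i /andP[_ iN] do rewrite (block_sum1 ub (bT i iN)).
  by rewrite -big_nat big_const_nat subn0 iter_addr_0 mulVf // pnatr_eq0 -lt0n.
have aS j : a j != 0 -> S j.
  move=> aj; apply: contrapT => nS; move: aj; rewrite /a big1 ?mulr0 ?eqxx // => i _.
  by apply/eqP/negPn/negP => /(block_supp ub)[].
pose F := [fset j in index_iota 0 T | (a j != 0) && (c' <= f (y j))]%fset.
have FP j : j \in F -> a j != 0 /\ c' <= f (y j).
  by rewrite !inE => /andP[_ /andP[]].
have DF : big_family y c' F.
  split=> [j /= /FP[/aS/SP.1]//|]; exists f => // j /FP[]//.
have FN : [set` F] `<=` N by move=> j /= /FP[/aS/SN.1].
have [G [GS FG]] := DN F DF FN.
have massF : \sum_(j <- F) a j <= 3 * k%:R / n%:R.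
  rewrite -mulr_sumr exchange_big /= mulrC ler_wpM2r ?invr_ge0 //.
  apply: (@le_trans _ _ (\sum_(0 <= i < n) \sum_(q <- index_iota 0 k) \sum_(m <- G q) repavg R L xi S i.+1 m)).
    apply: ler_sum => i _; apply: sum_cover; first exact: fset_uniq.
      exact: (block_ge0 ub).
    by move=> m /FG[q qk Gm] _; exists q => //; rewrite mem_index_iota.
  rewrite exchange_big /=; apply: (@le_trans _ _ (\sum_(0 <= q < k) 3)).
    by apply: ler_sum => q _; exact: (adS S SP (fun m Sm _ => Sm) (G q) (GS q) n).
  by rewrite big_const_nat subn0 iter_addr_0 mulr_natr.
have : \sum_(0 <= j < T) a j * f (y j) <= c' + C * \sum_(j <- F) a j.
  have FE : \sum_(j <- F) a j = \sum_(0 <= j < T | (a j != 0) && (c' <= f (y j))) a j.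
    rewrite -[RHS]big_filter; apply: perm_big; apply: uniq_perm.
    - exact: fset_uniq.
    - by rewrite filter_uniq // iota_uniq.
    - by move=> j; rewrite mem_filter !inE andbC.
  have {1}-> : c' = \sum_(0 <= j < T) c' * a j by rewrite -mulr_sumr a1 mulr1.
  rewrite FE mulr_sumr [X in _ + X]big_mkcond -big_split /=.
  apply: ler_sum => j _; case: ifP => [/andP[aj _]|].
    have fy : f (y j) <= C.
      apply: le_trans (ler_norm _) _; apply: le_trans ((dual_ballP f).1 fB _) _.
      by apply: yC; apply: SP.1; exact: aS.
    have := a0 j; nra.
  have [->|_ /=] := eqVneq (a j) 0; first by rewrite !(mul0r,mulr0) addr0.
  have [->|_ /=] := eqVneq (a j) 0; first by rewrite !(mul0r,mulr0) addr0.
  by move=> /negbT; rewrite -ltNge => /ltW fy; rewrite addr0 mulrC ler_wpM2r.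
rewrite -fE => fle; have := lt_le_trans cfn fle.
have n0R : 0 < n%:R :> R by rewrite ltr0n.
have : 3 * k%:R * C < (c - c') * n%:R.
  rewrite [ltRHS]mulrC -ltr_pdivrMr //; apply: lt_le_trans n0P _; by rewrite ler_nat.
rewrite -ltr_pdivrMr // => h1 h2.
have : C * \sum_(j <- F) a j <= 3 * k%:R * C / n%:R.
  by rewrite [leRHS]mulrAC mulrC ler_wpM2r.
lra.
Qed.

End Upper.

(** * Spreading models make averages oscillate *)

Section Lower.
Variables (R : realType) (X : completeNormedModType R) (W : omega1) (L : fundseq W).
Variables (xi : W) (y : nat -> X) (c C : R) (M : set nat).
Hypotheses (c0 : 0 < c) (sy : spreading_model L (osucc xi) y c).
Hypotheses (yC : bounded_by C y) (MP : infsub posnat M).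

Local Notation u := (repavg R L xi M).
Let z i := l1_dot (u i) (fun k => y (k ^ 3)%N).

Lemma cube_ge k : (k <= k ^ 3)%N.
Proof. by case: k => // k; rewrite expnS leq_pmulr // expn_gt0. Qed.

(** The combination is one of the $y_{k^3}$ with coefficients [gamma k].  As the
    supports are disjoint, these have the $\ell_1$-norm $\sum|\beta_i|$; and the
    cubes of the supports are at most $l\le j^3$ sets above $j^3$. *)
Lemma cube_blocks_lower j l (beta : nat -> R) : (0 < j)%N -> (l <= j ^ 3)%N ->
  c * (\sum_(j <= i < l.+1) `|beta i|) <= `|\sum_(j <= i < l.+1) beta i *: z i|.
Proof.
move=> j0 lj3; have [b ub] := repavg_blocks R L xi MP.
have binc := block_increasing ub.
have upred i : (0 < i)%N -> u i = u i.-1.+1 by move=> i0; rewrite prednK.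
pose T := (b l).+1.
have zE i : (j <= i < l.+1)%N -> z i = \sum_(0 <= k < T) u i k *: y (k ^ 3)%N.
  move=> /andP[ji il]; have i0 := leq_trans j0 ji.
  rewrite /z upred //; apply: (avg_dotE MP ub); rewrite ltnS prednK //.
  exact: increasing_le.
have uT i : (j <= i < l.+1)%N -> \sum_(0 <= k < T) u i k = 1.
  move=> /andP[ji il]; have i0 := leq_trans j0 ji.
  rewrite upred //; apply: (block_sum1 ub); rewrite ltnS prednK //.
  exact: increasing_le.
have disj i i' k : (0 < i)%N -> (0 < i')%N -> u i k != 0 -> u i' k != 0 -> i = i'.
  case: i i' => [//|i] [//|i'] _ _.
  move=> /(block_supp ub)[_ /andP[bi ib]] /(block_supp ub)[_ /andP[bi' ib']].
  case: (ltngtP i i') => [lt|lt|->//].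
    have := leq_trans (leq_ltn_trans (increasing_le binc lt) bi') ib.
    by rewrite ltnn.
  have := leq_trans (leq_ltn_trans (increasing_le binc lt) bi) ib'.
  by rewrite ltnn.
have u0 i k : (0 < i)%N -> 0 <= u i k.
  by case: i => // i _; exact: (block_ge0 ub).
pose gamma k := \sum_(j <= i < l.+1) beta i * u i k.
have gamma_supp k : gamma k != 0 -> exists2 i, (j <= i < l.+1)%N & u i k != 0.
  move=> gk; apply: contrapT => nex; move: gk; rewrite /gamma big_nat big1 ?eqxx // => i ji.
  by have [->|ui] := eqVneq (u i k) 0; [rewrite mulr0|case: nex; exists i].
have gammaE k : `|gamma k| = \sum_(j <= i < l.+1) `|beta i| * u i k.
  have [[i [ji ui]]|ex] := pselect (exists i, (j <= i < l.+1)%N /\ u i k != 0).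
    have ii : i \in index_iota j l.+1 by rewrite mem_index_iota.
    have rest i' : i' \in index_iota j l.+1 -> i' != i -> u i' k = 0.
      rewrite mem_index_iota => /andP[ji' _] ne; apply/eqP/negPn/negP => ui'.
      have := disj i' i k (leq_trans j0 ji') (leq_trans j0 (andP ji).1) ui' ui.
      by move=> e; rewrite e eqxx in ne.
    rewrite /gamma !(bigD1_seq i) ?iota_uniq //= big_seq_cond big1 ?addr0.
      rewrite [X in _ + X]big_seq_cond big1 ?addr0.
        by rewrite normrM [ `|u i k|]ger0_norm // u0 // (leq_trans j0 (andP ji).1).
      by move=> i' /andP[h ne]; rewrite rest // mulr0.
    by move=> i' /andP[h ne]; rewrite rest // mulr0.
  have uz i : (j <= i < l.+1)%N -> u i k = 0.
    by move=> ji; apply/eqP/negPn/negP => ui; apply: ex; exists i.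
  rewrite /gamma !big_nat !big1 ?normr0 // => i /uz->; exact: mulr0.
have sumE : \sum_(j <= i < l.+1) beta i *: z i = \sum_(0 <= k < T) gamma k *: y (k ^ 3)%N.
  rewrite big_nat; under eq_bigr => i ji do rewrite (zE i ji) scaler_sumr.
  rewrite -big_nat exchange_big; apply: eq_bigr => k _; rewrite scaler_suml.
  by apply: eq_bigr => i _; rewrite scalerA.
have normE : \sum_(j <= i < l.+1) `|beta i| = \sum_(0 <= k < T) `|gamma k|.
  under [RHS]eq_bigr do rewrite gammaE.
  rewrite [RHS]exchange_big [LHS]big_nat [RHS]big_nat; apply: eq_bigr => i ji.
  by rewrite -mulr_sumr uT // mulr1.
have cube_inj : injective (fun k : nat => k ^ 3)%N.
  by move=> k k' /eqP; rewrite eqn_exp2r // => /eqP.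
pose F0 := [fset k in index_iota 0 T | gamma k != 0]%fset.
have F0E k : k \in F0 = (k \in index_iota 0 T) && (gamma k != 0) by rewrite !inE.
have restrict (V : nmodType) (g : nat -> V) : (forall k, gamma k = 0 -> g k = 0) ->
    \sum_(0 <= k < T) g k = \sum_(k <- F0) g k.
  move=> g0; rewrite (bigID (fun k => gamma k != 0)) /= [X in _ + X]big1 ?addr0.
    rewrite -big_filter; apply: perm_big; apply: uniq_perm.
    - by rewrite filter_uniq // iota_uniq.
    - exact: fset_uniq.
    - by move=> k; rewrite mem_filter F0E andbC.
  by move=> k /negPn/eqP/g0.
pose F := [fset (k ^ 3)%N | k in F0]%fset.
pose root t := xget 0%N [set k | (k ^ 3)%N = t].
have rootK k : root (k ^ 3)%N = k.
  by rewrite /root; case: xgetP => [k' -> /cube_inj//|/(_ k)/= h]; case: h.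
rewrite normE sumE (restrict _ (fun k => `|gamma k|)); last by move=> k ->; rewrite normr0.
rewrite (restrict _ (fun k => gamma k *: y (k ^ 3)%N)); last by move=> k ->; rewrite scale0r.
have imE (V : nmodType) (g : nat -> V) : \sum_(k <- F0) g (k ^ 3)%N = \sum_(t <- F) g t.
  by apply/esym/big_imfset => k k' _ _; exact: cube_inj.
have -> : \sum_(k <- F0) `|gamma k| = \sum_(t <- F) `|gamma (root t)|.
  by rewrite -imE; apply: eq_bigr => k _; rewrite rootK.
have -> : \sum_(k <- F0) gamma k *: y (k ^ 3)%N = \sum_(t <- F) gamma (root t) *: y t.
  by rewrite -imE; apply: eq_bigr => k _; rewrite rootK.
apply: (sy (fun t => gamma (root t))).
have /choice[H HP] : forall i, exists F, schreier L xi F /\ forall m, m \in F <-> u i.+1 m != 0.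
  by move=> i; have [H SH HE] := repavg_schreier R L xi i MP; exists H.
pose G q := [fset (k ^ 3)%N | k in H (j + q).-2 & k \in F0]%fset.
rewrite schreierSE; apply: (@schreier_succ_union _ G (l.+1 - j)).
- move=> q _; apply: (schreier_spread_sub (HP (j + q).-2).1 (h := fun k => k ^ 3)%N).
  + by move=> k k' _ _ kk'; rewrite ltn_exp2r.
  + by move=> k _; exact: cube_ge.
  + apply/fsubsetP => t /imfsetP[k /= /andP[Hk _] ->].
    by apply/imfsetP; exists k.
- move=> q q' q1 qq' _ t t' /imfsetP[k /= /andP[/(HP _).2 Hk _] ->].
  move=> /imfsetP[k' /= /andP[/(HP _).2 Hk' _] ->]; rewrite ltn_exp2r //.
  move: Hk Hk' => /(block_supp ub)[_ /andP[_ kb]] /(block_supp ub)[_ /andP[bk' _]].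
  apply: leq_ltn_trans kb (leq_ltn_trans _ bk'); apply: increasing_le => //; lia.
- move=> t /imfsetP[k /=]; rewrite F0E => /andP[_ gk] ->.
  have [i /andP[ji il] ui] := gamma_supp k gk.
  have jk : (j <= k)%N.
    move: ui; rewrite upred ?(leq_trans j0 ji) // => /(block_supp ub)[_ /andP[bk _]].
    by have := increasing_ge i.-1 binc; lia.
  apply: (@leq_trans l); first by lia.
  by apply: leq_trans lj3 _; rewrite leq_exp2r.
- move=> t; split=> [/imfsetP[k /= Fk ->]|[q _ /imfsetP[k /= /andP[_ Fk] ->]]]; last first.
    by apply/imfsetP; exists k.
  have gk : gamma k != 0 by move: Fk; rewrite F0E => /andP[].
  have [i /andP[ji il] ui] := gamma_supp k gk.
  exists (i.+1 - j)%N; first by lia.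
  apply/imfsetP; exists k => //; apply/andP; split=> //; apply/(HP _).2.
  have -> : (j + (i.+1 - j)).-2 = i.-1 by lia.
  by rewrite -upred // (leq_trans j0 ji).
Qed.

(** With $t=1/j$, the means of orders $j^2$ and $j^3$ differ by
    $\sum\beta_iz_i$, where $|\beta_i|=t^2-t^3$ for $i\le j^2$ and $t^3$ after.
    The terms $i<j$ weigh at most $t$; the others have $\ell_1$-norm
    at least $2-3t$ and [cube_blocks_lower] applies to them. *)
Lemma ca_cesaro_cube_lower : 2 * c <= ca (cesaro_mean z).
Proof.
have C0 : 0 <= C by apply: le_trans (yC (ltnSn 0)).
have [b ub] := repavg_blocks R L xi MP.
have zC : bounded_by C z.
  by apply: (avg_dot_bounded MP ub) => k k0; apply: yC; rewrite expn_gt0 k0.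
apply: (le_ca (cesaro_bounded zC)) => n r n0 rc.
have rc0 : 0 < 2 * c - r by rewrite subr_gt0.
pose j := maxn n (Num.truncn ((3 * c + C) / (2 * c - r))).+1.
have j0 : (0 < j)%N by rewrite leq_max n0.
pose J : R := j%:R.
have J0 : 0 < J by rewrite ltr0n.
have J1 : 1 <= J by rewrite ler1n.
have Jbig : 3 * c + C < (2 * c - r) * J.
  rewrite [ltRHS]mulrC -ltr_pdivrMr //; apply: lt_le_trans (truncnS_gt _) _.
  by rewrite /J ler_nat leq_maxr.
have jj2 : (j <= j ^ 2)%N by rewrite expnS expn1 leq_pmulr.
have j23 : (j ^ 2 <= j ^ 3)%N by rewrite leq_pexp2l.
exists (j ^ 2)%N, (j ^ 3)%N; split.
- by apply: leq_trans jj2; rewrite leq_maxl.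
- by apply: leq_trans (leq_trans jj2 j23); rewrite leq_maxl.
set k := (j ^ 2)%N; set l := (j ^ 3)%N.
pose beta i : R := if (i <= k)%N then k%:R^-1 - l%:R^-1 else - l%:R^-1.
have wE : cesaro_mean z k - cesaro_mean z l = \sum_(1 <= i < l.+1) beta i *: z i.
  rewrite /cesaro_mean !scaler_sumr [in RHS](big_cat_nat (n := k.+1)) //=.
  rewrite [X in _ - X](big_cat_nat (n := k.+1)) //= opprD addrA -sumrB; congr (_ + _).
    rewrite !big_nat; apply: eq_bigr => i /andP[_ ik].
    by rewrite /beta -ltnS ik scalerBl.
  rewrite -sumrN !big_nat; apply: eq_bigr => i /andP[ik _].
  by rewrite /beta leqNgt ik scaleNr.
rewrite wE (big_cat_nat (n := j)) //=; last by rewrite ltnW // ltnS (leq_trans jj2).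
have lower := cube_blocks_lower beta j0 (leqnn _).
have kE : k%:R^-1 = J^-1 ^+ 2 by rewrite exprVn -natrX.
have lE : l%:R^-1 = J^-1 ^+ 3 by rewrite exprVn -natrX.
have t0 : 0 < J^-1 by rewrite invr_gt0.
have t1 : J^-1 <= 1 by rewrite invf_le1.
have tJ : J^-1 * J = 1 by rewrite mulVf // gt_eqF.
have small : `|\sum_(1 <= i < j) beta i *: z i| <= C * J^-1.
  apply: le_trans (ler_norm_sum _ _ _) _.
  apply: (@le_trans _ _ (\sum_(1 <= i < j) J^-1 ^+ 2 * C)).
    rewrite !big_nat; apply: ler_sum => i /andP[i0 ij].
    rewrite normrZ ler_pM ?normr_ge0 ?zC //.
    rewrite /beta (leq_trans (ltnW ij) jj2) kE lE ger0_norm.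
      by rewrite gerBl exprn_ge0 // ltW.
    by rewrite subr_ge0 exprS ler_piMl // exprn_ge0 // ltW.
  rewrite big_const_nat iter_addr_0 -mulr_natr.
  have : (j - 1)%:R <= J by rewrite ler_nat leq_subr.
  have : 0 <= J^-1 ^+ 2 * C by rewrite mulr_ge0 // exprn_ge0 // ltW.
  move: tJ; set t := J^-1; rewrite expr2 => tJ h1 h2.
  have -> : C * t = t * t * C * J by rewrite -[C * t]mulr1 -tJ; lra.
  by rewrite ler_wpM2l // -expr2.
have big : 2 - 3 * J^-1 <= \sum_(j <= i < l.+1) `|beta i|.
  rewrite (big_cat_nat (n := k.+1)) //=; last by rewrite leqW.
  have -> : \sum_(j <= i < k.+1) `|beta i| = (J^-1 ^+ 2 - J^-1 ^+ 3) * (k.+1 - j)%:R.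
    rewrite big_nat (eq_bigr (fun=> J^-1 ^+ 2 - J^-1 ^+ 3)).
      by rewrite -big_nat big_const_nat iter_addr_0 mulr_natr.
    move=> i /andP[_]; rewrite ltnS => ik; rewrite /beta ik kE lE ger0_norm //.
    by rewrite subr_ge0 [leLHS]exprS ler_piMl // exprn_ge0 // ltW.
  have -> : \sum_(k.+1 <= i < l.+1) `|beta i| = J^-1 ^+ 3 * (l - k)%:R.
    rewrite big_nat (eq_bigr (fun=> J^-1 ^+ 3)).
      by rewrite -big_nat big_const_nat iter_addr_0 subSS mulr_natr.
    move=> i /andP[ik _]; rewrite /beta leqNgt ik /= normrN lE ger0_norm //.
    by rewrite exprn_ge0 // ltW.
  have -> : (k.+1 - j)%:R = J ^+ 2 - J + 1 :> R.
    by rewrite subSn // -natr1 natrB // natrX.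
  have -> : (l - k)%:R = J ^+ 3 - J ^+ 2 :> R by rewrite natrB // !natrX.
  move: tJ t0 t1; set t := J^-1 => tJ t0 t1.
  have e2 : t ^+ 2 * J ^+ 2 = 1 by rewrite -exprMn tJ expr1n.
  have e3 : t ^+ 3 * J ^+ 3 = 1 by rewrite -exprMn tJ expr1n.
  have e21 : t ^+ 2 * J = t by rewrite expr2 -mulrA tJ mulr1.
  have e32 : t ^+ 3 * J ^+ 2 = t by rewrite exprS -mulrA e2 mulr1.
  have e31 : t ^+ 3 * J = t ^+ 2 by rewrite exprS -mulrA e21 expr2.
  have -> : (t ^+ 2 - t ^+ 3) * (J ^+ 2 - J + 1) + t ^+ 3 * (J ^+ 3 - J ^+ 2) =
    2 - 3 * t + (2 * t ^+ 2 - t ^+ 3).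
    by rewrite !(mulrDr, mulrBl, mulrN) e2 e3 e21 e32 e31; lra.
  rewrite lerDl subr_ge0 exprS; have := sqr_ge0 t; nra.
have h : r < c * (2 - 3 * J^-1) - C * J^-1.
  have : (3 * c + C) * J^-1 < 2 * c - r by rewrite ltr_pdivrMr.
  lra.
have h2 : c * (2 - 3 * J^-1) <= c * \sum_(j <= i < l.+1) `|beta i|.
  by rewrite ler_pM2l.
have := ler_normB (\sum_(1 <= i < j) beta i *: z i + \sum_(j <= i < l.+1) beta i *: z i)
  (\sum_(1 <= i < j) beta i *: z i).
rewrite addrAC subrr add0r; lra.
Qed.

End Lower.

(** * The four inequalities *)

Section Suprema.
Variable R : realType.
Implicit Types (S : set R) (r : R).

Lemma sup_le S r : 0 <= r -> (forall s, S s -> s <= r) -> sup S <= r.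
Proof.
move=> r0 Sr; have [S0|S0] := pselect (S !=set0); first exact: ge_sup.
rewrite sup_out // => -[]//.
Qed.

Lemma le_sup_bounded S r s : (forall t, S t -> t <= r) -> S s -> s <= sup S.
Proof. by move=> Sr Ss; apply: ub_le_sup => //; exists r. Qed.

Lemma sup_bounded_ge0 S r : (forall t, S t -> 0 <= t <= r) -> 0 <= sup S.
Proof.
move=> Sr; have [[s Ss]|S0] := pselect (S !=set0); last first.
  by rewrite sup_out // => -[].
have /andP[s0 _] := Sr s Ss; apply: le_trans s0 (le_sup_bounded (r := r) _ Ss).
by move=> t /Sr/andP[].
Qed.

End Suprema.

Section Main.
Variables (R : realType) (X : completeNormedModType R).
Variables (W : omega1) (L : fundseq W) (A : set X) (xi : W).

Lemma bounded_set_bound : bounded_set A -> exists C, forall a, A a -> `|a| <= C.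
Proof. by move=> /pinfty_ex_gt0[C _ AC]; exists C. Qed.

Variable C : R.
Hypothesis AC : forall a, A a -> `|a| <= C.

Lemma seq_in_bounded x : seq_in A x -> bounded_by C x.
Proof. by move=> Ax n n0; apply: AC; exact: Ax. Qed.

Lemma weak_limit_bounded x v : seq_in A x -> weakly_cvg x v -> `|v| <= C.
Proof.
move=> Ax xv; have [f fB fv] := norming_functional v.
rewrite leNgt; apply/negP => vC.
have e0 : 0 < f v - C by rewrite subr_gt0; apply: lt_le_trans fv.
have /cvgrPdist_lt/(_ _ e0)[n _ /(_ n.+1 (leqnSn n))] /= := xv f fB.1.
have h1 : f (x n.+1) <= C.
  apply: le_trans (ler_norm _) _; apply: le_trans ((dual_ballP f).1 fB _) _.
  exact: seq_in_bounded.
have := ler_norm (f v - f (x n.+1)); lra.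
Qed.

Lemma seq_in_bounded_sub x v : seq_in A x -> weakly_cvg x v ->
  bounded_by (2 * C) (fun n => x n - v).
Proof.
move=> Ax xv n n0; apply: le_trans (ler_normB _ _) _.
by rewrite mulr2n mulrDl mul1r lerD ?seq_in_bounded // (weak_limit_bounded Ax).
Qed.

Lemma cca_along_bounds x M : seq_in A x -> infsub posnat M ->
  0 <= cca_along L xi x M <= 2 * C.
Proof.
move=> Ax MP; have [b ub] := repavg_blocks R L xi MP.
have zC := cesaro_bounded (avg_dot_bounded MP ub (seq_in_bounded Ax)).
by rewrite /cca_along (ca_ge0 zC) (ca_le zC).
Qed.

Lemma inf_cca_bounds x M : seq_in A x -> infsub posnat M ->
  0 <= inf [set cca_along L xi x N | N in infsub M] <= 2 * C.
Proof.
move=> Ax MP.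
have MM : infsub M M := infsub_refl MP.2.
have bnd N : infsub M N -> 0 <= cca_along L xi x N <= 2 * C.
  by move=> MN; apply: cca_along_bounds => //; exact: infsub_trans MN.
apply/andP; split.
  apply: lb_le_inf; first by exists (cca_along L xi x M), M.
  by move=> _ [N MN <-]; have /andP[] := bnd N MN.
apply: (@le_trans _ _ (cca_along L xi x M)); last by have /andP[] := bnd M MM.
apply: ge_inf; last by exists M.
by exists 0 => _ [N MN <-]; have /andP[] := bnd N MN.
Qed.

Lemma posnat_inf : infsub posnat posnat. Proof. exact: infsub_refl infinite_posnat. Qed.

Lemma cca_tilde_bounds x : seq_in A x -> 0 <= cca_tilde L xi x <= 2 * C.
Proof. by move=> Ax; exact: inf_cca_bounds posnat_inf. Qed.

Lemma cca_tilde_le_s x : seq_in A x -> cca_tilde L xi x <= cca_tilde_s L xi x.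
Proof.
move=> Ax; apply: (le_sup_bounded (r := 2 * C)); last by exists posnat => //; exact: posnat_inf.
by move=> _ [M MP <-]; have /andP[] := inf_cca_bounds Ax MP.
Qed.

Lemma cca_tilde_s_bounds x : seq_in A x -> 0 <= cca_tilde_s L xi x <= 2 * C.
Proof.
move=> Ax; have /andP[h0 hC] := cca_tilde_bounds Ax.
rewrite (le_trans h0 (cca_tilde_le_s Ax)) /=; apply: sup_le; first exact: le_trans hC.
by move=> _ [M MP <-]; have /andP[] := inf_cca_bounds Ax MP.
Qed.

Lemma sm_set_bound (th : W) c x v : seq_in A x -> weakly_cvg x v ->
  spreading_model L th (fun n => x n - v) c -> c <= 2 * C.
Proof.
move=> Ax xv sx; have := sx [fset 1%N]%fset (fun=> 1) (schreier1 L th (ltnSn 0)).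
rewrite !big_seq_fset1 normr1 mulr1 scale1r => h.
exact: le_trans h (seq_in_bounded_sub Ax xv (ltnSn 0)).
Qed.

Lemma wus_set_bound (th : W) c x v : seq_in A x -> weakly_cvg x v ->
  large L th x v c -> c <= 2 * C.
Proof.
move=> Ax xv [M MP big]; have [|_ [f fB fF]] := big [fset elt M i | i in [fset 1]]%fset.
  by exists [fset 1%N]%fset => //; exact: schreier1.
have /fF h : elt M 1 \in [fset elt M i | i in [fset 1]]%fset.
  by apply/imfsetP; exists 1%N; rewrite ?inE.
apply: le_trans h _; apply: le_trans (ler_norm _) _.
apply: le_trans ((dual_ballP f).1 fB _) _.
by apply: (seq_in_bounded_sub Ax xv); apply: MP.1; exact: elt_in.
Qed.

Lemma sm_le_wbs : 2 * sm L (osucc xi) A <= wbs L xi A.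
Proof.
have wbs0 : 0 <= wbs L xi A.
  apply: (sup_bounded_ge0 (r := 2 * C)).
  by move=> _ [x [Ax _] <-]; exact: cca_tilde_bounds.
rewrite mulrC -ler_pdivlMr //; apply: sup_le; first by rewrite divr_ge0.
move=> c [c0 [x [v [Ax xv sx]]]]; rewrite ler_pdivlMr // mulrC.
pose x' k := x (k ^ 3)%N.
have Ax' : seq_in A x' by move=> n n0; apply: Ax; rewrite expn_gt0 n0.
have xv' : weakly_cvg x' v := weakly_cvg_sub cube_ge xv.
apply: (@le_trans _ _ (cca_tilde L xi x')); last first.
  apply: (le_sup_bounded (r := 2 * C)).
    by move=> _ [x1 [Ax1 _] <-]; have /andP[] := cca_tilde_bounds Ax1.
  by exists x' => //; split=> //; exists v.
apply: lb_le_inf; first by exists (cca_along L xi x' posnat), posnat => //; exact: posnat_inf.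
move=> _ [M MP <-].
apply: le_trans (ca_cesaro_cube_lower c0 sx (seq_in_bounded_sub Ax xv) MP) _.
have [b ub] := repavg_blocks R L xi MP.
have xC := cesaro_bounded (avg_dot_bounded MP ub (seq_in_bounded Ax')).
have yC := cesaro_bounded (avg_dot_bounded MP ub (seq_in_bounded_sub Ax' xv')).
apply: (le_ca xC) => n r n0 lt; have [k [l [nk nl]]] := lt_ca yC lt n0.
rewrite !(cesaro_avg_sub MP ub) ?(leq_trans n0) // opprB addrA subrK => h.
by exists k, l.
Qed.

Lemma wbs_le_wbs_s : wbs L xi A <= wbs_s L xi A.
Proof.
apply: sup_le.
  apply: (sup_bounded_ge0 (r := 2 * C)).
  by move=> _ [x [Ax _] <-]; exact: cca_tilde_s_bounds.
move=> _ [x [Ax xv] <-]; apply: le_trans (cca_tilde_le_s Ax) _.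
apply: (le_sup_bounded (r := 2 * C)); last by exists x.
by move=> _ [x1 [Ax1 _] <-]; have /andP[] := cca_tilde_s_bounds Ax1.
Qed.

Lemma wus_ge0 (th : W) : 0 <= wus L th A.
Proof.
apply: (sup_bounded_ge0 (r := 2 * C)).
by move=> c [c0 [x [v [Ax xv lx]]]]; rewrite ltW //= (wus_set_bound Ax xv lx).
Qed.

Lemma wbs_s_le_wus : wbs_s L xi A <= 2 * wus L (osucc xi) A.
Proof.
have w0 := wus_ge0 (osucc xi).
apply: sup_le; first exact: mulr_ge0.
move=> _ [x [Ax [v xv]] <-]; apply: sup_le; first exact: mulr_ge0.
move=> _ [M MP <-]; rewrite leNgt; apply/negP.
set I := inf _ => wI.
(* Room for [wus < c' < c] with [2 * c < I]. *)
pose d := (I - 2 * wus L (osucc xi) A) / 6.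
have d0 : 0 < d by rewrite divr_gt0 // subr_gt0.
have IE : I = 2 * wus L (osucc xi) A + 6 * d.
  by rewrite /d; lra.
pose c' := wus L (osucc xi) A + d; pose c := wus L (osucc xi) A + 2 * d.
have [||N MN big] := @large_of_averages _ _ _ L xi (fun n => x n - v) M _ c c'
    (seq_in_bounded_sub Ax xv) MP.
- by rewrite /c' /c; apply/andP; split; lra.
- move=> N n0 MN; have NP := infsub_trans MP MN.
  have [b ub] := repavg_blocks R L xi NP.
  have xC := cesaro_bounded (avg_dot_bounded NP ub (seq_in_bounded Ax)).
  have lt : 2 * c < cca_along L xi x N.
    apply: (@lt_le_trans _ _ I); first by rewrite IE /c; lra.
    apply: ge_inf; last by exists N.
    exists 0 => _ [N' MN' <-].
    by have /andP[] := cca_along_bounds Ax (infsub_trans MP MN').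
  have [k [l [nk nl]]] := lt_ca xC lt (ltn0Sn n0).
  have k0 := leq_ltn_trans (leq0n _) nk; have l0 := leq_ltn_trans (leq0n _) nl.
  move=> h; have := cesaro_avg_sub NP ub x v k0; have := cesaro_avg_sub NP ub x v l0.
  set wk := cesaro_mean _ k in h *; set wl := cesaro_mean _ l in h *.
  move=> el ek.
  have tri : `|wk - wl| <= `|wk - v| + `|wl - v|.
    by have := ler_normB (wk - v) (wl - v); rewrite opprB addrA subrK.
  have [ck|ck] := ltP c `|wk - v|; first by exists k; rewrite // ek.
  exists l => //; rewrite el; move: h; rewrite -/wk -/wl; lra.
have : c' <= wus L (osucc xi) A.
  apply: (le_sup_bounded (r := 2 * C)).
    by move=> c1 [_ [x1 [v1 [Ax1 xv1 lx1]]]]; exact: wus_set_bound Ax1 xv1 lx1.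
  split; first by rewrite /c'; lra.
  by exists x, v; split=> //; exists N => //; exact: infsub_trans MN.
by rewrite /c'; lra.
Qed.

Lemma wus_le_sm (th : W) : 2 * wus L th A <= 4 * sm L th A.
Proof.
have sm0 : 0 <= sm L th A.
  apply: (sup_bounded_ge0 (r := 2 * C)).
  by move=> c [c0 [x [v [Ax xv sx]]]]; rewrite ltW //= (sm_set_bound Ax xv sx).
suff : wus L th A <= 2 * sm L th A by lra.
apply: sup_le; first exact: mulr_ge0.
move=> c [c0 [x [v [Ax xv lx]]]]; rewrite leNgt; apply/negP => lt.
pose eps := (c - 2 * sm L th A) / 2.
have e0 : 0 < eps by rewrite divr_gt0 // subr_gt0.
have [x' [Ax' xv' sx']] := large_spreading_model c0 e0 Ax xv lx.
have : (c - eps) / 2 <= sm L th A.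
  apply: (le_sup_bounded (r := 2 * C)).
    by move=> c1 [_ [x1 [v1 [Ax1 xv1 sx1]]]]; exact: sm_set_bound Ax1 xv1 sx1.
  by split; [rewrite /eps; lra|exists x', v].
rewrite /eps; lra.
Qed.

End Main.

Theorem theorem3p2 (R : realType) (X : completeNormedModType R)
    (W : omega1) (L : fundseq W) (A : set X) (bndA : bounded_set A) (xi : W) :
  [/\ 2 * sm L (osucc xi) A <= wbs L xi A,
      wbs L xi A <= wbs_s L xi A,
      wbs_s L xi A <= 2 * wus L (osucc xi) A &
      2 * wus L (osucc xi) A <= 4 * sm L (osucc xi) A].
Proof.
have [C AC] := bounded_set_bound bndA; split.
- exact: sm_le_wbs AC.
- exact: wbs_le_wbs_s AC.
- exact: wbs_s_le_wus AC.
- exact: wus_le_sm AC _.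
Qed.
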